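(* Let $I\subseteq\mathbb R$ be a compact interval. Let $\mu=(\mu_j)_{j\ge1}$ be an admissible weight, $M_0>0$, and $M_1=M_0\mu_1>b_1>0$. Assume that $(\mu_{+1},M_1,|I|,b_1)$ is admissible and let $\mathbf N=\mathbf N(\mu_{+1},M_1,|I|,b_1)$. Let $f:I\to\mathbb R$ be a $(\mu^{|\mathbf N+1},M_0)$-smooth function satisfying $\|f'\|_I\ge b_1$. Then, for each Lebesgue measurable subset $E\subseteq I$ with $|E|>0$, $$\|f'\|_I\le2\,\mathbf C_{\mathbf N}\,\frac{|I|^{\mathbf N}}{|E|^{\mathbf N+1}}\,(\mathbf N+1)^2\,\|f\|_E.$$
   Context: $|E|$ denotes Lebesgue measure; $\|f\|_E:=\sup_{x\in E}|f(x)|$. Weights and smoothness. An admissible weight is a sequence $\mu=(\mu_j)_{j\ge1}$ of reals with $0<\mu_1\le\mu_2\le\cdots$. The shifted weight is $\mu_{+1}:=(\mu_{j+1})_{j\ge1}$. Given $M_0>0$ put $M_j=M_0\mu_1\cdots\mu_j$, $j\ge1$. For $N\in\mathbb N_{\ge1}\cup\{\infty\}$, a function $f:I\to\mathbb R$ is $(\mu^{|N},M_0)$-smooth if it is of class $C^N$ (in some open neighborhood of $I$) and $\sup_{x\in I}|f^{(j)}(x)|\le M_j$ for all integers $0\le j<N+1$. Degree. For an admissible weight $\lambda$ and $A,a,b>0$ let $j_0$ be the smallest nonnegative integer $\ge\log(A/b)$. The tuple $(\lambda,A,a,b)$ is admissible if $\sum_{j=j_0+1}^\infty 1/\lambda_j>a\,e$;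 then $\mathbf N(\lambda,A,a,b):=2\sup\{k\in\mathbb N:\sum_{j=j_0+1}^k\frac1{a\lambda_j}<e\}$ (empty sums are $0$). The constant $\mathbf C_{\mathbf N}$ is formed with the weight $\lambda=\mu_{+1}$: fix an increasing continuous, (piecewise) $C^1$ function $\tilde\lambda:[1,\infty)\to(0,\infty)$ with $\tilde\lambda(j)=\lambda_j$ for integers $j\ge1$ (left derivatives are used at points of nondifferentiability), put $\gamma_{\tilde\lambda}(k):=\sup_{1\le s\le k}\frac{s\tilde\lambda'(s)}{\tilde\lambda(s)}$, and $\mathbf C_{\mathbf N}:=(4e^{4+\gamma_{\tilde\lambda}(\mathbf N)})^{\mathbf N}$. *)

(* Defs.v *)
From mathcomp Require Import all_boot all_order all_algebra.
From mathcomp Require Import all_classical all_reals all_analysis.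

Set Implicit Arguments.
Unset Strict Implicit.
Unset Printing Implicit Defensive.

Import Order.TTheory GRing.Theory Num.Theory.
Import numFieldNormedType.Exports.

Local Open Scope classical_set_scope.
Local Open Scope ring_scope.

(* The Lebesgue sigma-algebra (Caratheodory-measurable sets, not only the Borel
   sets) and the completed Lebesgue measure. *)
Definition lebesgue_measurable (R : realType) (E : set R) : Prop :=
  ((wlength (idfun : R -> R))^*)%mu.-cara.-measurable E.

Definition lebesgue_size (R : realType) (E : set R) : R :=
  fine (@completed_lebesgue_measure R E).

(* [sup] is 0 on empty or unbounded sets; it is only meant for functions that are
   continuous near a compact interval containing E, with E nonempty. *)
Definition supnorm (R : realType) (E : set R) (f : R -> R) : R :=
  sup [set `|f x| | x in E].

(* Weights are indexed from 1: the value at 0 is never used. *)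
Definition admissible_weight (R : realType) (mu : nat -> R) : Prop :=
  0 < mu 1%N /\ (forall j : nat, (1 <= j)%N -> mu j <= mu j.+1).

Definition shift_weight (R : realType) (mu : nat -> R) : nat -> R :=
  fun j => mu j.+1.

Definition weight_prod (R : realType) (mu : nat -> R) (M0 : R) (j : nat) : R :=
  M0 * \prod_(1 <= i < j.+1) mu i.

Definition class_C (R : realType) (n : nat) (U : set R) (f : R -> R) : Prop :=
  (forall j : nat, (j < n)%N -> forall x, U x -> derivable (derive1n j f) x 1) /\
  (forall x, U x -> {for x, continuous (derive1n n f)}).

(* A function on I is given by a total function on R, of which only the values
   near I matter. *)
Definition weight_smooth (R : realType) (mu : nat -> R) (n : nat) (M0 : R)
    (I : set R) (f : R -> R) : Prop :=
  (exists U : set R, [/\ open U, I `<=` U & class_C n U f]) /\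
  (forall j : nat, (j <= n)%N -> supnorm I (derive1n j f) <= weight_prod mu M0 j).

Definition start_index (R : realType) (A b : R) : nat :=
  xget 0%N [set j : nat | ln (A / b) <= j%:R /\
    forall i : nat, ln (A / b) <= i%:R -> (j <= i)%N].

Definition admissible_tuple (R : realType) (lam : nat -> R) (A a b : R) : Prop :=
  [/\ admissible_weight lam, 0 < A, 0 < a, 0 < b &
    ((a * expR 1)%:E <
      \sum_((start_index A b).+1 <= j <oo) ((lam j)^-1)%:E)%E].

(* For an admissible tuple the set below is finite and contains 0, so its
   supremum is attained; the default value 0 then plays no role. *)
Definition degree (R : realType) (lam : nat -> R) (A a b : R) : nat :=
  (2 * supremum 0 [set k : nat |
    (\sum_((start_index A b).+1 <= j < k.+1) (a * lam j)^-1 < expR 1)%R])%N.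

(* Piecewise C^1 on [1, +oo[: on each interval of a locally finite subdivision,
   g is the restriction of a C^1 function on R (equivalently, g is C^1 up to
   the endpoints, with one-sided derivatives there). *)
Definition piecewise_C1 (R : realType) (g : R -> R) : Prop :=
  exists (t : nat -> R) (h : nat -> R -> R),
    [/\ t 0%N = 1, (forall i : nat, t i < t i.+1), t i @[i --> \oo] --> +oo &
      forall i : nat, class_C 1 [set: R] (h i) /\
        (forall x, t i <= x <= t i.+1 -> g x = h i x)].

Definition interpolates (R : realType) (lam : nat -> R) (lamt : R -> R) : Prop :=
  [/\ (forall s, 1 <= s -> 0 < lamt s),
      (forall s t, 1 <= s -> s <= t -> lamt s <= lamt t),
      {within `[1, +oo[, continuous lamt},
      piecewise_C1 lamt &
      forall j : nat, (1 <= j)%N -> lamt j%:R = lam j].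

(* The derivative of g : [1, +oo[ -> R with the left derivative at points of
   nondifferentiability: for s > 1 this is the left derivative, which is the
   derivative wherever g is differentiable; at the boundary point 1 the
   derivative is the one from the right. *)
Definition left_derive (R : realType) (g : R -> R) (s : R) : R :=
  if 1 < s then lim ((g (s + h) - g s) / h @[h --> 0^'-])
  else lim ((g (s + h) - g s) / h @[h --> 0^'+]).

(* The set is bounded when [lamt] is positive, nondecreasing and piecewise C^1. *)
Definition weight_gamma (R : realType) (lamt : R -> R) (k : R) : R :=
  sup [set s * left_derive lamt s / lamt s | s in `[1, k]].

Definition CN_const (R : realType) (lamt : R -> R) (N : nat) : R :=
  (4 * expR (4 + weight_gamma lamt N%:R)) ^+ N.

(* Main.v *)
(* Let g = f', lam = mu_(+1), L_n = M_(n+1) and N = 2K, with K the supremum in the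
   definition of the degree.
   - Bang: if |g^(n)(x)| < exp (n - k) L_n for all n < k, the same holds with k - 1
     at every point within distance 1 / (e lam_k) of x. As the steps 1 / (e lam_i),
     j0 < i <= K + 1, add up to at least |I|, starting from k = K + 1 at some x would
     force |g| < exp (- j0) M_1 <= b1 on all of I. So at every x in I some n <= K has
     |g^(n)(x)| >= exp (n - K - 1) L_n.
   - Cut I into pieces J of length at most r = N / (2 e^2 lam_N) (if |I| <= r take
     J = I, n = 0 and a maximum point of |f'|) and choose one containing at least its
     share of E. Interpolate f at N + 1 points of E in J spaced by |E n J| / (N + 1).
     The error in the derivative of order n + 1 <= K + 1 is at most half of the lower
     bound above since N >= 2n; Lagrange's formula bounds the rest by sup_E |f|.
   - gamma enters through lam_N / lam_j <= (N / j)^gamma; the resulting product is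
     (K N^n / n!)^gamma <= exp (gamma N). *)
Require Import Defs.
From mathcomp Require Import all_boot all_order all_algebra.
From mathcomp Require Import all_classical all_reals all_analysis.
From mathcomp Require Import ring lra zify.

Set Implicit Arguments.
Unset Strict Implicit.
Unset Printing Implicit Defensive.

Import Order.TTheory GRing.Theory Num.Theory.
Import numFieldNormedType.Exports.

Local Open Scope classical_set_scope.
Local Open Scope ring_scope.

(** * Families of successive derivatives, Rolle's theorem and bounds from zeros *)

(** An abstract family rather than iterated [derive1n], so that it can be shifted, restricted or
    corrected by a polynomial. Derivatives are two-sided even at [u] and [v], as for a function
    smooth near the interval. *)
Definition derivative_chain (R : realType) (n : nat) (u v : R)
    (F : nat -> R -> R) : Prop :=
  forall j, (j < n)%N -> forall x, u <= x <= v -> is_derive x 1 (F j) (F j.+1 x).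

Lemma derivative_chain_shift (R : realType) m n (u v : R) F :
  derivative_chain n u v F ->
  derivative_chain (n - m) u v (fun j => F (m + j)%N).
Proof. by move=> hF j jn x; rewrite addnS; apply: hF; rewrite -ltn_subRL. Qed.

Lemma derivative_chain_sub (R : realType) n (u v u' v' : R) F :
  u <= u' -> v' <= v -> derivative_chain n u v F -> derivative_chain n u' v' F.
Proof. by move=> uu vv hF j jn x /andP[h1 h2]; apply: hF => //; lra. Qed.

Lemma derivative_chainB_poly (R : realType) n (u v : R) F (P : {poly R}) :
  derivative_chain n u v F ->
  derivative_chain n u v (fun j x => F j x - P^`(j).[x]).
Proof.
move=> hF j jn x uxv; have h := hF j jn x uxv.
by rewrite derivnS; exact: is_deriveB.
Qed.

Lemma is_derive_within_continuous (R : realType) (f df : R -> R) (u v : R) :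
  (forall x, u <= x <= v -> is_derive x 1 f (df x)) ->
  {within `[u, v], continuous f}.
Proof.
move=> hf; apply: derivable_within_continuous => x.
by rewrite in_itv /= => /hf.
Qed.

(** Rolle between neighbours, by induction on the list. Keeping [path <%R x t] closes the induction:
    the later zeros lie to the right of [y], hence of the new zero [z < y]. *)
Lemma rolle_zeros (R : realType) (f df : R -> R) (u v x : R) (s : seq R) :
  (forall y, u <= y <= v -> is_derive y 1 f (df y)) ->
  path <%R x s -> all (fun y => (u <= y <= v) && (f y == 0)) (x :: s) ->
  exists t, [/\ size t = size s, path <%R x t &
    all (fun y => (u <= y <= v) && (df y == 0)) t].
Proof.
move=> hf; elim: s x => [|y s IH] x /=; first by exists [::].
move=> /andP[xy ps] /andP[/andP[/andP[ux xv] /eqP fx] /andP[/andP[/andP[uy yv] /eqP fy] hs]].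
have [|t [st pt ht]] := IH y ps; first by rewrite /= uy yv fy eqxx.
have [z zxy hz] : exists2 z, z \in `]x, y[%R & is_derive z 1 f 0.
  apply: Rolle => //; last by rewrite fx fy.
    move=> z; rewrite in_itv /= => /andP[xz zy].
    by have [] := hf z _; [apply/andP; split; lra|].
  apply: (@is_derive_within_continuous _ _ df) => z /andP[xz zy].
  by apply: hf; apply/andP; split; lra.
move: zxy; rewrite in_itv /= => /andP[xz zy].
have uzv : u <= z <= v by apply/andP; split; lra.
exists (z :: t); rewrite /= st xz uzv ht andbT; split => //.
  by case: t pt {st ht} => //= a l /andP[ya ->]; rewrite (lt_trans zy ya).
apply/eqP; have h := hf z uzv.
by rewrite -(@derive_val _ _ _ _ _ _ _ h) (@derive_val _ _ _ _ _ _ _ hz).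
Qed.

Lemma iter_rolle_zeros (R : realType) (F : nat -> R -> R) n k (u v : R) (s : seq R) :
  derivative_chain n u v F -> (k <= n)%N -> (k < size s)%N -> sorted <%R s ->
  all (fun y => (u <= y <= v) && (F 0%N y == 0)) s ->
  exists t, [/\ size t = (size s - k)%N, sorted <%R t &
    all (fun y => (u <= y <= v) && (F k y == 0)) t].
Proof.
move=> hF; elim: k => [|k IH] kn ks ss zs; first by exists s; rewrite subn0.
have [[|x t] [st pt ht]] := IH (ltnW kn) (ltnW ks) ss zs.
  by move: st => /=; lia.
have [t' [st' pt' ht']] := rolle_zeros (hF k kn) pt ht.
exists t'; split => //; first by rewrite st'; move: st => /=; lia.
exact: path_sorted pt'.
Qed.

Lemma derivn_size_prod_XsubC (R : realType) (s : seq R) :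
  (\prod_(z <- s) ('X - z%:P))^`(size s) = ((size s)`!)%:R%:P.
Proof.
set W := \prod_(z <- s) _.
have sW : size W = (size s).+1 by rewrite /W size_prod_XsubC.
have mW : lead_coef W = 1 by apply/monicP/monic_prod_XsubC.
have s1 : (size W^`(size s) <= 1)%N.
  by apply/leq_sizeP => j j1; rewrite coef_derivn nth_default ?mul0rn // sW; lia.
rewrite (size1_polyC s1); congr (_%:P).
rewrite coef_derivn addn0 ffactnn.
by move: mW; rewrite lead_coefE sW /= => ->.
Qed.

(* Apply Rolle to [F - c W], with [W] the nodal polynomial and [c] chosen so that
   [y] becomes an extra zero. *)
Lemma zeros_bound (R : realType) (F : nat -> R -> R) k (u v M : R) (s : seq R) y :
  derivative_chain k u v F -> size s = k -> (0 < k)%N -> sorted <%R s ->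
  all (fun y => (u <= y <= v) && (F 0%N y == 0)) s ->
  (forall x, u <= x <= v -> `|F k x| <= M) ->
  u <= y <= v ->
  `|F 0%N y| <= M * (v - u) ^+ k / (k`!)%:R.
Proof.
move=> hF sk k0 ss zs hM uyv.
have M0 : 0 <= M by apply: le_trans (hM y uyv).
have uv : 0 <= v - u by move: uyv => /andP[? ?]; lra.
have kf : 0 < (k`!)%:R :> R by rewrite ltr0n fact_gt0.
set W := \prod_(z <- s) ('X - z%:P).
have [ys|ys] := boolP (y \in s).
  have /allP/(_ y ys)/andP[_ /eqP ->] := zs.
  by rewrite normr0 divr_ge0 ?mulr_ge0 ?exprn_ge0 // ltW.
have Wy : W.[y] != 0 by rewrite -/(root W y) root_prod_XsubC.
pose c := F 0%N y / W.[y].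
pose H := fun j x => F j x - (c *: W)^`(j).[x].
have hH : derivative_chain k u v H by apply: derivative_chainB_poly.
pose s' := sort <=%R (y :: s).
have us : uniq (y :: s) by rewrite /= ys; apply: (sorted_uniq lt_trans ltxx).
have ss' : sorted <%R s' by rewrite sort_lt_sorted.
have zs' : all (fun y => (u <= y <= v) && (H 0%N y == 0)) s'.
  rewrite all_sort /= uyv /H derivn0 hornerZ /c divfK // subrr eqxx /=.
  apply/allP => z zs'; have /allP/(_ z zs')/andP[-> /eqP ->] := zs.
  have : root W z by rewrite root_prod_XsubC.
  by rewrite sub0r oppr_eq0 hornerZ mulf_eq0 rootE => ->; rewrite orbT.
(* The [k + 1] zeros of [H 0] leave one zero [xi] of [H k], where [F k xi = c k!]; this determines
   [F 0 y = c W(y)]. *)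
have [|t [st _ ht]] := iter_rolle_zeros hH (leqnn k) _ ss' zs'.
  by rewrite size_sort /= sk.
move: st; rewrite size_sort /= sk subSnn; case: t ht => // xi [] // /andP[+ _] _.
move=> /andP[uxi]; rewrite /H derivnZ hornerZ -sk derivn_size_prod_XsubC hornerC.
rewrite sk subr_eq0 => /eqP Fxi.
have -> : F 0%N y = F k xi * W.[y] / (k`!)%:R.
  rewrite Fxi /c; move/eqP: (gt_eqF kf); move: Wy => /eqP.
  set w := W.[y]; set q := _%:R => w0 q0; field.
  by apply/andP; split; apply/eqP.
rewrite !normrM normfV (ger0_norm (ltW kf)) ler_wpM2r ?invr_ge0 ?(ltW kf) //.
apply: ler_pM => //; first exact: hM.
rewrite /W horner_prod -sk normr_prod.
have : all (fun z => u <= z <= v) s by apply: sub_all zs => z /andP[].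
elim: (s) => [|z r IH] /=; first by rewrite big_nil expr0.
move=> /andP[/andP[uz zv] hr]; rewrite big_cons exprS ler_pM //.
- by apply: prodr_ge0.
- by rewrite hornerXsubC ler_norml; move: uyv => /andP[? ?]; apply/andP; split; lra.
- exact: IH.
Qed.

(** * Growth estimates and Bang's propagation of smallness *)

(** [G + F] and [G - F] have nonnegative derivatives, so the mean value theorem applies to both; the
    sign [e] treats them together. *)
Lemma le_dist_dominated (R : realType) (F dF G dG : R -> R) (x y : R) :
  x <= y ->
  (forall z, x <= z <= y -> is_derive z 1 F (dF z)) ->
  (forall z, x <= z <= y -> is_derive z 1 G (dG z)) ->
  (forall z, x <= z <= y -> `|dF z| <= dG z) ->
  `|F y - F x| <= G y - G x.
Proof.
move=> xy hF hG hd.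
have key (e : R) : `|e| = 1 -> 0 <= (G y - G x) + e * (F y - F x).
  move=> e1.
  have hH z : x <= z <= y -> is_derive z 1 (G + e *: F) (dG z + e *: dF z).
    by move=> hz; have h1 := hF z hz; have h2 := hG z hz; apply: is_deriveD.
  have [z zxy] := MVT_segment xy
    (fun z hz => hH z (subset_itv_oo_cc hz)) (is_derive_within_continuous hH).
  rewrite in_itv /= in zxy.
  have -> : (G + e *: F) y - (G + e *: F) x = (G y - G x) + e * (F y - F x).
    by change (G y + e * F y - (G x + e * F x) = (G y - G x) + e * (F y - F x)); ring.
  move=> ->; apply: mulr_ge0; last by lra.
  have := hd z zxy; have : `|e *: dF z| = `|dF z| by rewrite normrM e1 mul1r.
  by have := ler_norm (- (e *: dF z)); rewrite normrN; lra.
have h1 := key 1 (normr1 _).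
have h2 := key (-1) (normrN1 _).
by rewrite ler_norml; apply/andP; split; lra.
Qed.

(** The bound on [dF] is, up to sign, the derivative of [C * expR (c * |z - x|)]; each side of [x]
    is compared with its own branch of this majorant. *)
Lemma le_norm_expR_growth (R : realType) (F dF : R -> R) (u v x y C c : R) :
  0 <= C -> 0 <= c ->
  (forall z, u <= z <= v -> is_derive z 1 F (dF z)) ->
  u <= x <= v -> u <= y <= v ->
  (forall z, u <= z <= v -> `|dF z| <= C * c * expR (c * `|z - x|)) ->
  `|F y| <= `|F x| + C * (expR (c * `|y - x|) - 1).
Proof.
move=> C0 c0 hF hx hy hd.
have tri : `|F y| <= `|F x| + `|F y - F x|.
  by rewrite addrC; apply: le_trans (ler_normD _ _); rewrite subrK.
apply: (le_trans tri); rewrite lerD2l.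
have [xy|yx] := leP x y.
  rewrite (ger0_norm (_ : 0 <= y - x)); last lra.
  have := @le_dist_dominated _ F dF (fun z => C * expR (c * (z - x)))
    (fun z => C * (expR (c * (z - x)) * c)) x y xy.
  rewrite subrr mulr0 expR0 mulr1 (mulrBr C) mulr1; apply => z hz.
  - by apply: hF; lra.
  - apply: is_derive_eq; rewrite /GRing.scale /=; ring.
  - have := hd z; rewrite (ger0_norm (_ : 0 <= z - x)); last lra.
    by move=> h; apply: le_trans (h _) _; [lra|rewrite -mulrA (mulrC c)].
rewrite distrC (ltr0_norm (_ : y - x < 0)) ?opprB; last lra.
have := @le_dist_dominated _ F dF (fun z => - (C * expR (c * (x - z))))
    (fun z => C * (expR (c * (x - z)) * c)) y x (ltW yx).
rewrite subrr mulr0 expR0 mulr1 opprK (mulrBr C) mulr1 [- C + _]addrC; apply => z hz.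
- by apply: hF; lra.
- apply: is_derive_eq; rewrite /GRing.scale /=; ring.
- have := hd z; rewrite (ler0_norm (_ : z - x <= 0)); last lra.
  by rewrite opprB => h; apply: le_trans (h _) _; [lra|rewrite -mulrA (mulrC c)].
Qed.

(** Vacuous for [k = 0]: a contradiction can only be read off at a level [k > 0], through
    [n = 0]. *)
Definition bang_small (R : realType) (G : nat -> R -> R) (L : nat -> R)
    (k : nat) (x : R) : Prop :=
  forall n, (n < k)%N -> `|G n x| < expR (n%:R - k%:R) * L n.

(* With [n + i = k + 1], [|G n z|] stays below
   [exp (- i) * L n * exp (e * lam_(k+1) * |z - x|)]: this majorant absorbs its own
   derivative, by downward induction on [n]. *)
Lemma bang_small_step (R : realType) (G : nat -> R -> R) (L lam : nat -> R)
    (u v : R) (k : nat) (x y : R) :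
  derivative_chain k.+1 u v G ->
  (forall z, u <= z <= v -> `|G k.+1 z| <= L k.+1) ->
  (forall n, 0 < L n) -> (forall n, L n.+1 = L n * lam n.+1) ->
  (forall n, (n <= k)%N -> lam n.+1 <= lam k.+1) ->
  u <= x <= v -> u <= y <= v -> `|y - x| <= (expR 1 * lam k.+1)^-1 ->
  bang_small G L k.+1 x -> bang_small G L k y.
Proof.
move=> hG hk L0 LS hlam hx hy hxy small.
have lam0 : 0 < lam k.+1 by have := L0 k.+1; rewrite LS pmulr_rgt0.
set c := expR 1 * lam k.+1.
have c0 : 0 < c by rewrite mulr_gt0 ?expR_gt0.
(* At [i = 0], that is [n = k + 1], only the global bound [hk] is available and the inequality is
   weak; for [i > 0] smallness at [x] makes it strict. *)
have main i n : (n + i = k.+1)%N -> forall z, u <= z <= v ->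
    `|G n z| < expR (- i%:R) * L n * expR (c * `|z - x|) ?<= if (i == 0)%N.
  elim: i n => [|i IH] n nik z hz.
    rewrite addn0 in nik; rewrite nik oppr0 expR0 mul1r /=.
    apply: le_trans (hk z hz) _; rewrite ler_peMr ?(ltW (L0 _)) //.
    by rewrite -expR0 ler_expR mulr_ge0 // ltW.
  rewrite /=.
  have nk : (n < k.+1)%N by rewrite -nik addnS ltnS leq_addr.
  have C0 : 0 <= expR (- i.+1%:R) * L n by rewrite mulr_ge0 ?expR_ge0 // ltW.
  apply: le_lt_trans (le_norm_expR_growth C0 (ltW c0) (hG n nk) hx hz _) _.
    move=> w hw; have := lteifW (IH n.+1 _ w hw); rewrite addSnnS => /(_ nik) h.
    apply: le_trans h _; rewrite ler_wpM2r ?expR_ge0 // LS /c.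
    rewrite [leRHS](_ : _ = (expR (- i.+1%:R) * expR 1) * (L n * lam k.+1)).
      rewrite -expRD -natr1 opprD addrNK ler_wpM2l ?expR_ge0 //.
      by rewrite ler_wpM2l ?(ltW (L0 _)) // hlam //; lia.
    by ring.
  have := small n nk; have -> : n%:R - k.+1%:R = - i.+1%:R :> R.
    by rewrite -nik natrD; ring.
  by rewrite mulrBr mulr1; lra.
move=> n nk; have nik : (n + (k.+1 - n) = k.+1)%N by lia.
have := main _ n nik y hy.
have -> : ((k.+1 - n)%N == 0%N) = false by apply/eqP; lia.
rewrite /= => h; apply: lt_le_trans h _.
(* Since [c * |y - x| <= 1], the exponential factor costs at most [e], which is exactly the passage
   from level [k + 1] to level [k]. *)
have -> : expR (n%:R - k%:R) = expR (- (k.+1 - n)%:R) * expR 1 :> R.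
  by rewrite -expRD natrB -?natr1; [congr expR; ring|lia].
rewrite [leRHS]mulrAC ler_wpM2l ?mulr_ge0 ?expR_ge0 ?ler_expR //; first exact: ltW.
by rewrite mulrC -ler_pdivlMr // mul1r.
Qed.

(** Going down from level [k] to [k - 1] allows a move of length [1 / (e lam_k)]. The moves go along
    the segment from [x] to [y], hence stay in the interval. *)
Lemma bang_small_propagate (R : realType) (G : nat -> R -> R) (L lam : nat -> R)
    (u v : R) (j k : nat) (x y : R) :
  derivative_chain k u v G ->
  (forall n z, (n <= k)%N -> u <= z <= v -> `|G n z| <= L n) ->
  (forall n, 0 < L n) -> (forall n, L n.+1 = L n * lam n.+1) ->
  (forall n m, (n <= m)%N -> lam n.+1 <= lam m.+1) ->
  (j <= k)%N -> u <= x <= v -> u <= y <= v ->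
  `|y - x| <= \sum_(j.+1 <= i < k.+1) (expR 1 * lam i)^-1 ->
  bang_small G L k x -> bang_small G L j y.
Proof.
move=> hG hGL L0 LS hlam jk hx hy.
have lam0 n : 0 < lam n.+1 by have := L0 n.+1; rewrite LS pmulr_rgt0.
have c0 n : 0 < (expR 1 * lam n.+1)^-1 by rewrite invr_gt0 mulr_gt0 ?expR_gt0.
elim: k jk x hx hG hGL => [|k IH].
  rewrite leqn0 => /eqP -> x hx _ _.
  by rewrite big_geq // normr_le0 subr_eq0 => /eqP ->.
rewrite leq_eqVlt => /predU1P[-> x hx _ _|jk x hx hG hGL].
  by rewrite big_geq // normr_le0 subr_eq0 => /eqP ->.
rewrite ltnS in jk.
rewrite big_nat_recr ?ltnS //=; set S := \sum_(_ <= _ < _) _; set t := _^-1.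
move=> hyx small.
have t0 : 0 < t by exact: c0.
have S0 : 0 <= S by rewrite /S big_nat sumr_ge0 // => -[|i] // _; exact/ltW/c0.
(* The share of the first move in the budget [S + t]: its length is then at most [t], and the
   distance left is at most [S]. *)
pose th := t / (S + t).
have th0 : 0 <= th by rewrite divr_ge0 //; lra.
have th1 : th <= 1 by rewrite ler_pdivrMr; lra.
have thS : th * (S + t) = t by rewrite divfK // gt_eqF //; lra.
pose z := x + th * (y - x).
have hz : u <= z <= v.
  move: hx hy => /andP[? ?] /andP[? ?]; rewrite /z.
  by apply/andP; split; nra.
apply: (IH jk z hz) => //.
- by move=> i ik; apply: hG; exact: ltnW.
- by move=> n w nk; apply: hGL; exact: leqW.
- have -> : y - z = (1 - th) * (y - x) by rewrite /z; ring.
  rewrite normrM ger0_norm; last lra.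
  apply: le_trans (_ : (1 - th) * (S + t) <= _); first by rewrite ler_wpM2l //; lra.
  by rewrite mulrBl mul1r thS addrK.
- apply: (bang_small_step (lam := lam) hG _ L0 LS _ hx hz _ small).
  + by move=> w; apply: hGL.
  + by move=> n nk; apply: hlam.
  + have -> : z - x = th * (y - x) by rewrite /z; ring.
    by rewrite normrM ger0_norm // -/t -thS ler_wpM2l.
Qed.

(** If every order failed at [x], smallness at level [K + 1] would spread to level [j] at [y]; since
    [j > 0], the case [n = 0] contradicts the lower bound there. *)
Lemma exists_large_derivative (R : realType) (G : nat -> R -> R) (L lam : nat -> R)
    (u v : R) (j K : nat) (x y : R) :
  derivative_chain K.+1 u v G ->
  (forall n z, (n <= K.+1)%N -> u <= z <= v -> `|G n z| <= L n) ->
  (forall n, 0 < L n) -> (forall n, L n.+1 = L n * lam n.+1) ->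
  (forall n m, (n <= m)%N -> lam n.+1 <= lam m.+1) ->
  (0 < j <= K)%N -> u <= x <= v -> u <= y <= v ->
  v - u <= \sum_(j.+1 <= i < K.+2) (expR 1 * lam i)^-1 ->
  expR (- j%:R) * L 0%N <= `|G 0%N y| ->
  exists n, (n <= K)%N /\ expR (n%:R - K.+1%:R) * L n <= `|G n x|.
Proof.
move=> hG hGL L0 LS hlam /andP[j0 jK] hx hy hs hjy.
apply: contrapT => /forallNP H.
have small : bang_small G L K.+1 x.
  by move=> n nK; have /not_andP[//|/negP] := H n; rewrite -ltNge.
have xy : `|y - x| <= v - u.
  by move: hx hy => /andP[? ?] /andP[? ?]; rewrite ler_norml; apply/andP; split; lra.
have := bang_small_propagate hG hGL L0 LS hlam (leqW jK) hx hy (le_trans xy hs) small j0.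
by rewrite sub0r ltNge hjy.
Qed.

(** * Nodal polynomials and Lagrange interpolation *)

Lemma derivnM_XsubC (R : comNzRingType) (z : R) (Q : {poly R}) m :
  (('X - z%:P) * Q)^`(m.+1) = ('X - z%:P) * Q^`(m.+1) + Q^`(m) *+ m.+1.
Proof.
elim: m => [|m IH].
  by rewrite derivn1 derivM derivXsubC mul1r derivn0 addrC mulr1n.
rewrite derivnS IH derivD derivM derivXsubC mul1r derivMn -!derivnS.
by rewrite addrAC -mulrS addrC.
Qed.

(** The derivative is a sum of [size s ^_ m] products of [size s - m] linear factors. The induction
    removes one node by Leibniz's rule and matches the recursion of falling factorials. *)
Lemma norm_derivn_prod_XsubC (R : realType) (s : seq R) m (x l : R) :
  (forall z, z \in s -> `|x - z| <= l) -> 0 <= l ->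
  `|(\prod_(z <- s) ('X - z%:P))^`(m).[x]| <=
     (size s ^_ m)%:R * l ^+ (size s - m).
Proof.
move=> hs l0; elim: s m hs => [|z s IH] m hs.
  rewrite big_nil; case: m => [|m].
    by rewrite derivn0 hornerC normr1 ffactn0 expr0 mulr1.
  by rewrite derivnC hornerC normr0 mulr_ge0 ?exprn_ge0.
have {}IH := IH ^~ (fun z' h => hs z' (mem_behead (s := z :: s) h)).
have hz : `|x - z| <= l by apply: hs; rewrite mem_head.
rewrite big_cons; case: m => [|m].
  rewrite derivn0 hornerM normrM hornerXsubC ffactn0 mul1r /= exprS.
  have := IH 0%N; rewrite derivn0 ffactn0 mul1r subn0 => h.
  exact: ler_pM.
rewrite derivnM_XsubC hornerD hornerM hornerXsubC hornerMn.
apply: le_trans (ler_normD _ _) _; rewrite normrM normrMn /= subSS.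
apply: le_trans (_ : l * ((size s ^_ m.+1)%:R * l ^+ (size s - m.+1)) +
   ((size s ^_ m)%:R * l ^+ (size s - m)) *+ m.+1 <= _).
  apply: lerD; last exact: ler_wMn2r (IH m).
  exact: ler_pM (IH m.+1).
rewrite ffactSS -[(_ * _) *+ _]mulr_natr.
(* For [m >= size s] the truncated exponents no longer drop by one, and falling factorials vanish
   instead. *)
have [ms|ms] := ltnP m (size s).
  have e : (size s - m = (size s - m.+1).+1)%N by rewrite subnSK.
  rewrite ffactnSr e exprS !natrM -!natr1.
  have -> : (size s)%:R = m%:R + ((size s - m.+1)%:R + 1) :> R.
    by rewrite natr1 -natrD -e subnKC // ltnW.
  set a := (_ ^_ _)%:R; set b := _ ^+ _; set q := (_ - _)%:R.
  by rewrite le_eqVlt; apply/orP; left; apply/eqP; ring.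
rewrite (@ffact_small (size s) m.+1) // !(mulr0, mul0r) add0r.
move: ms; rewrite leq_eqVlt => /predU1P[->|ms].
  by rewrite natrM mulrAC (mulrC (_%:R)).
by rewrite ffact_small // muln0 !(mulr0, mul0r).
Qed.

(** The distances from [i] run through [1, ..., i] on the left and [1, ..., N - i] on the right. *)
Lemma prod_subn_distances i N : (i <= N)%N ->
  (\prod_(j <- iota 0 N.+1 | j != i) (if j < i then i - j else j - i) =
   i`! * (N - i)`!)%N.
Proof.
move=> iN; rewrite -[iota 0 _]/(index_iota 0 N.+1).
rewrite (big_cat_nat (n := i)) //=; last exact: leqW.
rewrite [X in (_ * X)%N]big_ltn_cond //= eqxx /=; congr (_ * _)%N.
  rewrite big_nat_cond; under eq_big => [j|j].
    have -> : ((0 <= j < i)%N && (j != i)) = (0 <= j < i)%N && true.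
      by case: ltnP; rewrite ?andbF //= => ji; rewrite (ltn_eqF ji).
    over.
  by move=> /andP[/andP[_ ->] _]; over.
  rewrite -big_nat_cond big_nat_rev fact_prod big_add1 /=.
  by apply: eq_big_nat => j /andP[_ ji]; lia.
rewrite big_nat_cond; under eq_big => [j|j].
    have -> : ((i < j < N.+1)%N && (j != i)) = (i < j < N.+1)%N && true.
      by case: ltnP; rewrite ?andbF //= => ji; rewrite (gtn_eqF ji).
    over.
  by move=> /andP[/andP[ij _] _]; rewrite ltnNge (ltnW ij) /=; over.
rewrite -big_nat_cond -{1}[i.+1]add0n big_addn subSS fact_prod big_add1 /=.
by apply: eq_big_nat => j _; lia.
Qed.

(** The binomial expansion of [(1 + 1) ^ N], divided by [N!]. *)
Lemma sum_inv_fact (R : realType) N :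
  \sum_(i < N.+1) ((i`! * (N - i)`!)%:R)^-1 = 2 ^+ N / (N`!)%:R :> R.
Proof.
have -> : 2 = 1 + 1 :> R by [].
rewrite exprDn mulr_suml; apply: eq_bigr => i _.
have iN : (i <= N)%N by rewrite -ltnS.
rewrite !expr1n mulr1 -(bin_fact iN) [in RHS]natrM invfM mulrA mulfV ?mul1r //.
by rewrite pnatr_eq0 -lt0n bin_gt0.
Qed.

(** Not normalised: the value at the node [x i] is divided out in [lagrange_interp]. *)
Definition lagrange_basis (R : realType) (x : nat -> R) (N i : nat) : {poly R} :=
  \prod_(z <- [seq x j | j <- iota 0 N.+1 & j != i]) ('X - z%:P).

Definition lagrange_interp (R : realType) (f : R -> R) (x : nat -> R) (N : nat) :
    {poly R} :=
  \sum_(i < N.+1) (f (x i) / (lagrange_basis x N i).[x i]) *: lagrange_basis x N i.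

Lemma size_lagrange_nodes (R : realType) (x : nat -> R) N i : (i <= N)%N ->
  size [seq x j | j <- iota 0 N.+1 & j != i] = N.
Proof.
move=> iN; rewrite size_map size_filter.
have := count_predC (pred1 i) (iota 0 N.+1).
by rewrite size_iota count_uniq_mem ?iota_uniq // mem_iota /= ltnS iN => -[].
Qed.

Lemma size_lagrange_interp (R : realType) (f : R -> R) (x : nat -> R) N :
  (size (lagrange_interp f x N) <= N.+1)%N.
Proof.
apply: leq_trans (size_sum _ _ _) _; apply/bigmax_leqP => i _.
apply: leq_trans (size_scale_leq _ _) _.
by rewrite /lagrange_basis size_prod_XsubC size_lagrange_nodes // -ltnS.
Qed.

Lemma spaced_dist (R : realType) (x : nat -> R) (N : nat) (d : R) : 0 < d ->
  (forall i, (i < N)%N -> x i + d <= x i.+1) ->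
  forall i j, (i <= j <= N)%N -> (j - i)%:R * d <= x j - x i.
Proof.
move=> d0 hx i; elim=> [|j IH] /andP[ij jN].
  by move: ij; rewrite leqn0 => /eqP ->; rewrite subn0 mul0r subrr.
move: ij; rewrite leq_eqVlt => /predU1P[->|ij]; first by rewrite subnn mul0r subrr.
rewrite ltnS in ij; rewrite subSn // -natr1 mulrDl mul1r.
have := hx j jN; have := IH (introT andP (conj ij (ltnW jN))); lra.
Qed.

(** Nodes with gaps at least [d] are at least as far apart as the integers scaled by [d]. *)
Lemma lagrange_basis_ge (R : realType) (x : nat -> R) (N i : nat) (d : R) : 0 < d ->
  (forall i, (i < N)%N -> x i + d <= x i.+1) -> (i <= N)%N ->
  d ^+ N * (i`! * (N - i)`!)%:R <= `|(lagrange_basis x N i).[x i]|.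
Proof.
move=> d0 hx iN; have hd := spaced_dist d0 hx.
rewrite -(prod_subn_distances iN) /lagrange_basis horner_prod normr_prod.
rewrite -{1}(size_lagrange_nodes x iN) size_map -big_filter big_map.
have : all (fun j => (j <= N)%N && (j != i)) [seq j <- iota 0 N.+1 | j != i].
  by apply/allP => j; rewrite mem_filter mem_iota add0n ltnS andbC.
elim: [seq _ <- _ | _] => [|j s IH] /=; first by rewrite !big_nil mulr1.
move=> /andP[/andP[jN ji] hs]; rewrite !big_cons exprS natrM mulrACA.
rewrite ler_pM ?IH ?mulr_ge0 ?exprn_ge0 ?(ltW d0) // hornerXsubC.
case: ltnP => [lji|lij]; rewrite mulrC.
  by apply: le_trans (ler_norm _); apply: hd; rewrite (ltnW lji).
by rewrite distrC; apply: le_trans (ler_norm _); apply: hd; rewrite lij.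
Qed.

Lemma lagrange_basis_neq0 (R : realType) (x : nat -> R) (N i : nat) (d : R) : 0 < d ->
  (forall i, (i < N)%N -> x i + d <= x i.+1) -> (i <= N)%N ->
  (lagrange_basis x N i).[x i] != 0.
Proof.
move=> d0 hx iN; rewrite -normr_gt0; apply: lt_le_trans (lagrange_basis_ge d0 hx iN).
by rewrite mulr_gt0 ?exprn_gt0 // ltr0n muln_gt0 !fact_gt0.
Qed.

Lemma lagrange_interpE (R : realType) (f : R -> R) (x : nat -> R) (N k : nat) (d : R) : 0 < d ->
  (forall i, (i < N)%N -> x i + d <= x i.+1) -> (k <= N)%N ->
  (lagrange_interp f x N).[x k] = f (x k).
Proof.
move=> d0 hx kN; rewrite /lagrange_interp horner_sum.
have kN' : (k < N.+1)%N by [].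
rewrite (bigD1 (Ordinal kN')) //= big1 ?addr0.
  by rewrite hornerZ divfK // (lagrange_basis_neq0 d0 hx).
move=> i ik; rewrite hornerZ; apply/eqP; rewrite mulf_eq0; apply/orP; right.
rewrite -rootE root_prod_XsubC; apply/mapP; exists k => //.
rewrite mem_filter mem_iota /= ltnS kN andbT.
by apply: contraNneq ik => ki; apply/eqP/val_inj.
Qed.

(** Each basis polynomial is bounded above by its number of factors and below at its node by
    [lagrange_basis_ge]; [sum_inv_fact] adds up the resulting coefficients. *)
Lemma norm_derivn_lagrange_interp (R : realType) (f : R -> R) (x : nat -> R)
    (N m : nat) (d y l S : R) : 0 < d -> 0 <= l ->
  (forall i, (i < N)%N -> x i + d <= x i.+1) ->
  (forall i, (i <= N)%N -> `|f (x i)| <= S) ->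
  (forall i, (i <= N)%N -> `|y - x i| <= l) ->
  `|(lagrange_interp f x N)^`(m).[y]| <=
    S * (2 ^+ N / (N`!)%:R) * ((N ^_ m)%:R * l ^+ (N - m)) / d ^+ N.
Proof.
move=> d0 l0 hx hS hy.
rewrite /lagrange_interp raddf_sum /= horner_sum.
apply: le_trans (ler_norm_sum _ _ _) _.
rewrite -sum_inv_fact mulr_sumr mulr_suml mulr_suml; apply: ler_sum => i _.
have iN : (i <= N)%N by rewrite -ltnS.
rewrite derivnZ hornerZ normrM normrM normfV -mulrA.
have hb := lagrange_basis_ge d0 hx iN.
have b0 : 0 < d ^+ N * (i`! * (N - i)`!)%:R :> R.
  by rewrite mulr_gt0 ?exprn_gt0 // ltr0n muln_gt0 !fact_gt0.
have h2 : `|(lagrange_basis x N i)^`(m).[y]| <= (N ^_ m)%:R * l ^+ (N - m).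
  have := @norm_derivn_prod_XsubC R [seq x j | j <- iota 0 N.+1 & j != i :> nat] m y l.
  rewrite (size_lagrange_nodes x iN); apply => // z.
  by move=> /mapP[j]; rewrite mem_filter mem_iota /= ltnS => /andP[_ jN] ->; exact: hy.
have h3 : `|(lagrange_basis x N i).[x i]|^-1 <= (d ^+ N * (i`! * (N - i)`!)%:R)^-1.
  by rewrite lef_pV2 // posrE (lt_le_trans b0).
apply: le_trans (_ : S * ((d ^+ N * (i`! * (N - i)`!)%:R)^-1 *
   ((N ^_ m)%:R * l ^+ (N - m))) <= _).
  apply: ler_pM => //; rewrite ?mulr_ge0 ?invr_ge0 //; first exact: hS.
  by apply: ler_pM; rewrite ?invr_ge0.
by rewrite invfM le_eqVlt; apply/orP; left; apply/eqP; ring.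
Qed.

(* The derivatives of order [m <= N] of the interpolation error have [N + 1 - m]
   zeros. *)
Lemma norm_derivative_le_interp (R : realType) (F : nat -> R -> R) (x : nat -> R)
    (N m : nat) (d u v y S M : R) : 0 < d -> (m <= N)%N ->
  derivative_chain N.+1 u v F ->
  (forall z, u <= z <= v -> `|F N.+1 z| <= M) ->
  (forall i, (i < N)%N -> x i + d <= x i.+1) ->
  (forall i, (i <= N)%N -> u <= x i <= v) ->
  (forall i, (i <= N)%N -> `|F 0%N (x i)| <= S) ->
  u <= y <= v ->
  `|F m y| <= S * (2 ^+ N / (N`!)%:R) * ((N ^_ m)%:R * (v - u) ^+ (N - m)) / d ^+ N +
    M * (v - u) ^+ (N.+1 - m) / ((N.+1 - m)`!)%:R.
Proof.
move=> d0 mN hF hM hx huv hS hy.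
pose P := lagrange_interp (F 0%N) x N.
pose H := fun j z => F j z - P^`(j).[z].
have hH : derivative_chain N.+1 u v H by apply: derivative_chainB_poly.
have l0 : 0 <= v - u by move: hy => /andP[? ?]; lra.
have -> : F m y = P^`(m).[y] + H m y by rewrite /H addrC subrK.
apply: le_trans (ler_normD _ _) _; apply: lerD.
  apply: norm_derivn_lagrange_interp => // i iN.
  move: (huv i iN) hy => /andP[? ?] /andP[? ?].
  by rewrite ler_norml; apply/andP; split; lra.
have zs : all (fun z => (u <= z <= v) && (H 0%N z == 0)) [seq x i | i <- iota 0 N.+1].
  apply/allP => _ /mapP[i + ->]; rewrite mem_iota /= ltnS => iN.
  by rewrite (huv i iN) /H derivn0 (lagrange_interpE _ d0 hx iN) subrr eqxx.
have ss : sorted <%R [seq x i | i <- iota 0 N.+1].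
  rewrite sorted_map; apply: (sub_in_sorted (P := [pred i | (i <= N)%N]) (e := ltn)).
  - move=> i j /=; rewrite !inE => iN jN ij /=; rewrite -subr_gt0.
    apply: lt_le_trans (spaced_dist d0 hx (_ : (i <= j <= N)%N)).
      by rewrite mulr_gt0 // ltr0n subn_gt0.
    by rewrite (ltnW ij).
  - by apply/allP => i; rewrite mem_iota /= ltnS.
  - exact: iota_ltn_sorted.
have [|t [st pt ht]] := iter_rolle_zeros hH (leqW mN) _ ss zs.
  by rewrite size_map size_iota ltnS.
rewrite size_map size_iota in st.
(* The chain is shifted by [m], so its top member has order [N + 1], where the interpolating
   polynomial has disappeared. *)
have := @zeros_bound R (fun j => H (m + j)%N) (N.+1 - m) u v M t y
  (derivative_chain_shift hH) st _ pt.
rewrite addn0 subnKC ?leqW //; apply => //; first by rewrite subn_gt0 ltnS.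
move=> z hz; rewrite /H.
have -> : P^`(N.+1) = 0.
  apply/polyP => j; rewrite coef_derivn coef0 nth_default ?mul0rn //.
  by apply: leq_trans (size_lagrange_interp _ _ _) _; rewrite leq_addr.
by rewrite horner0 subr0; apply: hM.
Qed.

(** * Outer measure and well-spaced points of a set *)

Lemma completed_lebesgue_measure_itvcc (R : realType) (a b : R) : a <= b ->
  completed_lebesgue_measure `[a, b]%classic = (b - a)%:E.
Proof.
move=> ab; rewrite -[LHS]/(@lebesgue_measure R `[a, b]%classic).
rewrite lebesgue_measure_itv /= lte_fin.
move: ab; rewrite le_eqVlt => /predU1P[->|ab]; first by rewrite ltxx subrr.
by rewrite ab EFinB.
Qed.

Lemma lebesgue_size_itvcc (R : realType) (a b : R) : a <= b ->
  lebesgue_size `[a, b]%classic = b - a.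
Proof. by move=> ab; rewrite /lebesgue_size completed_lebesgue_measure_itvcc. Qed.

(* Only the outer measure is needed below, so that measurability plays no role. *)
Definition lebesgue_outer (R : realType) : {outer_measure set (ocitv_type R) -> \bar R} :=
  ((wlength (idfun : R -> R))^*)%mu.

Lemma lebesgue_outerE (R : realType) (E : set R) :
  lebesgue_outer R E = completed_lebesgue_measure E.
Proof. by []. Qed.

(** A greedy choice: take [x0] close to the infimum of [F], discard what lies left of [x0 + d], and
    continue with the rest, which has lost little more than [d] in outer measure. *)
Lemma spaced_points (R : realType) (F : set R) (u v d : R) n : 0 <= d ->
  F `<=` `[u, v] -> ((n%:R * d)%:E < lebesgue_outer R F)%E ->
  exists x : nat -> R, (forall i, (i <= n)%N -> F (x i)) /\
    (forall i, (i < n)%N -> x i + d <= x i.+1).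
Proof.
move=> d0; elim: n F => [|n IH] F Fuv hF.
  have [x Fx] : F !=set0.
    by apply/set0P; apply: contraTneq hF => ->; rewrite outer_measure0 mul0r ltxx.
  by exists (fun=> x); split => // i; rewrite leqn0 => /eqP ->.
have F0 : F !=set0.
  apply/set0P; apply: contraTneq hF => ->; rewrite outer_measure0 -leNgt.
  by rewrite lee_fin mulr_ge0.
have uv : u <= v.
  by have [x /Fuv] := F0; rewrite /= in_itv /= => /andP[]; apply: le_trans.
have fin : lebesgue_outer R F \is a fin_num.
  rewrite ge0_fin_numE ?outer_measure_ge0 //.
  apply: le_lt_trans (le_outer_measure (lebesgue_outer R) _ _ Fuv) _.
  by rewrite lebesgue_outerE completed_lebesgue_measure_itvcc // ltry.
set m := fine (lebesgue_outer R F).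
have mE : lebesgue_outer R F = m%:E by rewrite fineK.
move: hF; rewrite mE lte_fin => hm.
have hinf : has_inf F.
  by split => //; exists u => x /Fuv; rewrite /= in_itv /= => /andP[].
(* The slack in the strict hypothesis bounds the distance from [inf F] to [x0], so that more than
   [n d] is left for [F']. *)
have e0 : 0 < m - n.+1%:R * d by lra.
have [x0 Fx0 hx0] := inf_adherent e0 hinf.
pose F' := F `&` [set y | x0 + d <= y].
have sx0 : inf F <= x0 by apply: inf_lbound => //; case: hinf.
have hF' : ((n%:R * d)%:E < lebesgue_outer R F')%E.
  have sub : F `<=` `[inf F, x0 + d] `|` F'.
    move=> y Fy; have [h|h] := leP (x0 + d) y; first by right.
    left; rewrite /= in_itv /= (ltW h) andbT; apply: inf_lbound => //.
    by case: hinf.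
  have := le_trans (le_outer_measure (lebesgue_outer R) _ _ sub)
    (outer_measureU2 _ _ _).
  rewrite mE {1}lebesgue_outerE completed_lebesgue_measure_itvcc; last lra.
  case: (lebesgue_outer R F') (outer_measure_ge0 (lebesgue_outer R) F') => [r| |] //=.
    rewrite -EFinD !lee_fin lte_fin => _.
    by move: hm hx0; rewrite -natr1 mulrDl mul1r; lra.
  by rewrite ltry.
have [|x [h1 h2]] := IH F' _ hF'; first by move=> y [/Fuv].
exists (fun i => if i is j.+1 then x j else x0); split.
  by case=> // i /h1[].
case=> [_|i /h2 //]; by have [] := h1 0%N.
Qed.

Lemma itv_piece (R : realType) (u h x : R) p : u <= x -> x <= u + p%:R * h ->
  (0 < p)%N -> exists2 q, (q < p)%N & u + q%:R * h <= x <= u + q.+1%:R * h.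
Proof.
move=> ux; elim: p => // -[|p] IH xp _.
  by exists 0%N => //; rewrite mul0r addr0 ux.
have [hx|hx] := leP (u + p.+1%:R * h) x; first by exists p.+1; rewrite ?hx.
by have [q qp hq] := IH (ltW hx) isT; exists q => //; rewrite ltnW.
Qed.

Lemma lebesgue_outer_pieces (R : realType) (E : set R) (u h c : R) p :
  E `<=` `[u, u + p%:R * h] ->
  (forall q, (q < p)%N -> (lebesgue_outer R (E `&` `[(u + q%:R * h)%R, (u + q.+1%:R * h)%R])
     <= c%:E)%E) ->
  (0 < p)%N ->
  (lebesgue_outer R E <= (p%:R * c)%:E)%E.
Proof.
move=> hE hc p0.
pose J q := E `&` `[u + q%:R * h, u + q.+1%:R * h]%classic.
have sub : E `<=` \big[setU/set0]_(q < p) J q.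
  move=> x Ex; have := hE x Ex; rewrite /= in_itv /= => /andP[ux xp].
  have [q qp hq] := itv_piece ux xp p0.
  by rewrite -bigcup_mkord; exists q => //; split => //; rewrite /= in_itv.
apply: le_trans (le_outer_measure (lebesgue_outer R) _ _ sub) _.
apply: le_trans (outer_measure_subadditive _ _ _) _.
apply: le_trans (lee_sum _ (g := fun=> c%:E) _) _.
  by move=> q _; apply: hc.
by rewrite sumEFin lee_fin sumr_const card_ord mulr_natl.
Qed.

(** By subadditivity some piece carries its share of [E]. Its [N + 1] points have only [N] gaps, and
    the factor [N / (N + 1) < 1] supplies the strict inequality required by [spaced_points]. *)
Lemma exists_spaced_points (R : realType) (E : set R) (u v : R) (p N : nat) :
  u <= v -> E `<=` `[u, v] -> 0 < lebesgue_size E -> (0 < p)%N ->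
  exists (q : nat) (x : nat -> R),
    [/\ (q < p)%N, (forall i, (i <= N)%N -> E (x i)),
     (forall i, (i <= N)%N ->
        u + q%:R * ((v - u) / p%:R) <= x i <= u + q.+1%:R * ((v - u) / p%:R)) &
     (forall i, (i < N)%N -> x i + lebesgue_size E / p%:R / N.+1%:R <= x i.+1)].
Proof.
move=> uv Euv; set e := lebesgue_size E => e0 p0.
set h := (v - u) / p%:R; set d := e / p%:R / N.+1%:R.
have p0' : 0 < p%:R :> R by rewrite ltr0n.
have d0 : 0 <= d by rewrite !divr_ge0 // ltW.
have eE : lebesgue_outer R E = e%:E.
  rewrite lebesgue_outerE /e /lebesgue_size fineK //.
  rewrite ge0_fin_numE -?lebesgue_outerE ?outer_measure_ge0 //.
  apply: le_lt_trans (le_outer_measure (lebesgue_outer R) _ _ Euv) _.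
  by rewrite lebesgue_outerE completed_lebesgue_measure_itvcc // ltry.
have vE : v = u + p%:R * h.
  by rewrite /h mulrC divfK ?gt_eqF // addrC subrK.
pose J q := E `&` `[u + q%:R * h, u + q.+1%:R * h]%classic.
have [q [qp hq]] : exists q, (q < p)%N /\ ((N%:R * d)%:E < lebesgue_outer R (J q))%E.
  apply: contrapT => /forallNP H.
  have : (lebesgue_outer R E <= (p%:R * (N%:R * d))%:E)%E.
    apply: (@lebesgue_outer_pieces _ E u h) => //; first by rewrite -vE.
    by move=> q qp; have /not_andP[//|/negP] := H q; rewrite -leNgt.
  rewrite eE lee_fin leNgt => /negP; apply.
  have -> : p%:R * (N%:R * d) = e * (N%:R / N.+1%:R).
    by rewrite /d; field; rewrite !gt_eqF //= addrC natr1 gt_eqF.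
  by rewrite gtr_pMr // ltr_pdivrMr // mul1r ltr_nat.
have [|x [h1 h2]] := spaced_points (u := u) (v := v) d0 _ hq.
  by move=> y [/Euv].
exists q, x; split => // i iN; first by case: (h1 i iN).
by have [_] := h1 i iN; rewrite /= in_itv.
Qed.

(** * One-sided derivatives and the growth of the interpolated weight *)

Lemma left_derive_left (R : realType) (g h : R -> R) (a s dh : R) :
  is_derive s 1 h dh -> a < s -> 1 < s ->
  (forall y, a <= y <= s -> g y = h y) -> left_derive g s = dh.
Proof.
move=> [hd <-] as_ s1 gh; rewrite /left_derive s1; apply: cvg_lim => //.
have := cvg_dnbhs_at_left (p := 0) hd; apply: cvg_trans; apply: near_eq_cvg.
near=> e.
have e0 : e < 0 by near: e; exact: nbhs_left_lt.
have ae : a - s < e by near: e; apply: nbhs_left_gt; lra.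
rewrite !gh; [|lra|lra].
by rewrite /= mulrC; congr (_ * (h _ - h s)); rewrite /GRing.scale /= mulr1 addrC.
Unshelve. all: by end_near. Qed.

Lemma left_derive_one (R : realType) (g h : R -> R) (b dh : R) :
  is_derive (1 : R) 1 h dh -> 1 < b ->
  (forall y, 1 <= y <= b -> g y = h y) -> left_derive g 1 = dh.
Proof.
move=> [hd <-] b1 gh; rewrite /left_derive ltxx; apply: cvg_lim => //.
have := cvg_dnbhs_at_right (p := 0) hd; apply: cvg_trans; apply: near_eq_cvg.
near=> e.
have e0 : 0 < e by near: e; exact: nbhs_right_gt.
have ae : e < b - 1 by near: e; apply: nbhs_right_lt; lra.
rewrite !gh; [|lra|lra].
by rewrite /= mulrC; congr (_ * (h _ - h 1)); rewrite /GRing.scale /= mulr1 addrC.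
Unshelve. all: by end_near. Qed.

Lemma class_C1_is_derive (R : realType) (h : R -> R) (x : R) :
  class_C 1 [set: R] h -> is_derive x 1 h (derive1 h x).
Proof.
by move=> [hd _]; rewrite derive1E; apply: derivableP; apply: (hd 0%N).
Qed.

Lemma subdivision_ge1 (R : realType) (t : nat -> R) :
  t 0%N = 1 -> (forall i, t i < t i.+1) -> forall i, 1 <= t i.
Proof.
move=> t0 ht; elim=> [|i IH]; first by rewrite t0.
exact: le_trans IH (ltW (ht i)).
Qed.

(** The half-open form leaves room to the left of [s] inside the piece, as a left derivative
    requires. *)
Lemma subdivision_piece (R : realType) (t : nat -> R) (s : R) m :
  t 0%N = 1 -> 1 < s -> s <= t m ->
  exists2 i, (i < m)%N & t i < s <= t i.+1.
Proof.
move=> t0 s1; elim: m => [|m IH] sm; first by rewrite t0 in sm; lra.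
have [h|h] := leP s (t m).
  by have [i im hi] := IH h; exists i => //; exact: ltnW.
by exists m => //; rewrite h sm.
Qed.

Lemma derive_bounded_pieces (R : realType) (t : nat -> R) (h : nat -> R -> R) m :
  (forall i, t i < t i.+1) -> (forall i, class_C 1 [set: R] (h i)) ->
  exists2 B, 0 <= B &
    forall i s, (i < m)%N -> t i <= s <= t i.+1 -> `|derive1 (h i) s| <= B.
Proof.
move=> ht hh; elim: m => [|m [B B0 IH]]; first by exists 0.
have cont : {within `[t m, t m.+1], continuous (fun s => `|derive1 (h m) s|)}.
  apply: continuous_subspaceT => s; apply: continuous_comp; last exact: norm_continuous.
  by have [_ /(_ s I)] := hh m.
have [c _ hc] := EVT_max (ltW (ht m)) cont.
exists (Num.max B `|derive1 (h m) c|); first by rewrite le_max B0.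
move=> i s; rewrite ltnS leq_eqVlt => /predU1P[->|im] hs; rewrite le_max.
  by rewrite hc ?orbT // in_itv.
by rewrite IH.
Qed.

(** A real [sup] dominates only a bounded set. Here [s <= N], finitely many compact pieces bound the
    derivative, and [lamt s >= lamt 1]. *)
Lemma weight_gamma_ub (R : realType) (lam : nat -> R) (lamt : R -> R) (N s : R) :
  interpolates lam lamt -> 1 <= s <= N ->
  s * left_derive lamt s / lamt s <= weight_gamma lamt N.
Proof.
move=> [pos mono _ [t [h [t0 ht tinf hh]]] _] /andP[s1 sN].
have [m hm] : exists m, N <= t m.
  have [m _ hm] := (cvgryPge _).1 tinf N.
  by exists m; apply: hm => /=.
have t1 := subdivision_ge1 t0 ht.
have [B B0 hB] := derive_bounded_pieces m.+1 ht (fun i => (hh i).1).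
have dB r : 1 <= r <= N -> `|left_derive lamt r| <= B.
  move=> /andP[r1 rN]; move: r1; rewrite le_eqVlt => /predU1P[<-|r1].
    rewrite (left_derive_one (b := t 1%N) (class_C1_is_derive 1 (hh 0%N).1)).
    - by apply: hB => //; rewrite t0 lexx -t0 ltW.
    - by rewrite -t0.
    - by move=> y hy; apply: (hh 0%N).2; rewrite t0.
  have [i im /andP[tr rt]] := subdivision_piece t0 r1 (le_trans rN hm).
  rewrite (left_derive_left (class_C1_is_derive r (hh i).1) tr) //.
  - by apply: hB; [exact: ltnW|rewrite (ltW tr)].
  - by move=> y /andP[ty yr]; apply: (hh i).2; rewrite ty (le_trans yr).
rewrite /weight_gamma; apply: ub_le_sup; last by exists s => //=; rewrite in_itv /= s1.
exists (N * B / lamt 1) => w [r /=]; rewrite in_itv /= => /andP[r1 rN] <-.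
have l1 := pos 1 (lexx _); have lr := pos r r1.
have hr : left_derive lamt r <= B.
  by apply: le_trans (ler_norm _) (dB r _); rewrite r1.
apply: le_trans (_ : N * B / lamt r <= _).
  rewrite ler_wpM2r ?invr_ge0 ?(ltW lr) //.
  apply: le_trans (_ : r * B <= _); first by rewrite ler_wpM2l //; lra.
  by rewrite ler_wpM2r.
rewrite ler_wpM2l ?mulr_ge0 //; first by lra.
by rewrite lef_pV2 // mono.
Qed.

(** On each piece [ln lamt - g ln] has nonpositive derivative; the increments over successive pieces
    add up. *)
Lemma interpolates_ln_growth (R : realType) (lam : nat -> R) (lamt : R -> R) (N x y : R) :
  interpolates lam lamt -> 1 <= x -> x <= y -> y <= N ->
  ln (lamt y) - ln (lamt x) <= weight_gamma lamt N * (ln y - ln x).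
Proof.
move=> hint x1 xy yN; have hg s := @weight_gamma_ub _ _ _ N s hint.
move: (hint) => [pos mono _ [t [h [t0 ht tinf hh]]] _].
set g := weight_gamma lamt N in hg *.
have t1 := subdivision_ge1 t0 ht.
have piece i a b : t i <= a -> a <= b -> b <= t i.+1 -> b <= N ->
    ln (lamt b) - ln (lamt a) <= g * (ln b - ln a).
  move=> ta; rewrite le_eqVlt => /predU1P[->|ab] bt bN; first by rewrite !subrr mulr0.
  have hE z : a <= z <= b -> lamt z = h i z.
    by move=> /andP[az zb]; apply: (hh i).2; apply/andP; split; lra.
  have hpos z : a <= z <= b -> 0 < h i z.
    move=> hz; rewrite -hE //; apply: pos; have := t1 i; lra.
  have hz0 z : a <= z <= b -> 0 < z by have := t1 i; lra.
  pose D z := derive1 (h i) z / h i z - g * z^-1.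
  have hD z : a <= z <= b -> is_derive z 1 (fun z => ln (h i z) - g * ln z) (D z).
    move=> hz; have h1 := class_C1_is_derive z (hh i).1.
    have h2 := is_derive1_ln (hpos z hz); have h3 := is_derive1_ln (hz0 z hz).
    have h4 : is_derive z 1 (fun z => ln (h i z)) ((h i z)^-1 * derive1 (h i) z).
      exact: is_derive1_comp.
    by apply: is_derive_eq; rewrite /D /GRing.scale /= mulrC.
  have [z zab] := MVT ab (fun z hz => hD z (subset_itv_oo_cc hz))
    (is_derive_within_continuous hD).
  rewrite in_itv /= in zab; move: zab => /andP[az zb].
  have hz : a <= z <= b by rewrite (ltW az) (ltW zb).
  have z1 : 1 < z by have := t1 i; lra.
  (* [weight_gamma_ub] bounds [z * lamt'(z) / lamt z] by [g], the left derivative at [z > t i] being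
     that of [h i]. *)
  have D0 : D z <= 0.
    have tz : t i < z by lra.
    have := hg z _; rewrite (left_derive_left (class_C1_is_derive z (hh i).1) tz) //.
    - move=> /(_ _) H; have {}H := H (ltac:(lra)).
      rewrite /D subr_le0 ler_pdivlMr ?hz0 // mulrC mulrA -(hE z hz).
      exact: H.
    - by move=> w hw; apply: (hh i).2; lra.
  rewrite !hE; [|lra|lra].
  have := mulr_le0_ge0 D0 (_ : 0 <= b - a); rewrite subr_ge0 (ltW ab) => /(_ isT).
  by move=> H E; move: H; rewrite -E; lra.
have [m hm] : exists m, y <= t m.
  have [m _ hm] := (cvgryPge _).1 tinf y.
  by exists m; apply: hm => /=.
(* Pieces are crossed one at a time: [piece] covers the part beyond [t m], the induction hypothesis
   the rest. *)
elim: m y xy yN hm => [|m IH] y xy yN hm.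
  have -> : y = x by move: hm; rewrite t0; lra.
  by rewrite !subrr mulr0.
have [h1|h1] := leP y (t m); first exact: IH.
have [h2|h2] := leP x (t m); last by apply: (piece m) => //; exact: ltW.
have := IH (t m) h2 (le_trans (ltW h1) yN) (lexx _).
have := piece m (t m) y (lexx _) (ltW h1) hm yN.
by lra.
Qed.

Lemma interpolates_ratio (R : realType) (lam : nat -> R) (lamt : R -> R) (N i j : nat) :
  interpolates lam lamt -> (0 < i)%N -> (i <= j <= N)%N ->
  lam j <= lam i * expR (weight_gamma lamt N%:R * (ln j%:R - ln i%:R)).
Proof.
move=> hint i0 /andP[ij jN].
have j0 : (0 < j)%N by exact: leq_trans ij.
have := @interpolates_ln_growth _ _ _ N%:R i%:R j%:R hint.
rewrite ler1n !ler_nat => /(_ i0 ij jN).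
case: (hint) => pos _ _ _ lamE.
have hi : 0 < lam i by rewrite -lamE // pos // ler1n.
have hj : 0 < lam j by rewrite -lamE // pos // ler1n.
rewrite !lamE // => h.
rewrite -ler_pdivrMl // mulrC -[leLHS]lnK ?posrE ?divr_gt0 // ler_expR.
by rewrite ln_div ?posrE.
Qed.

(** Between [1] and [N] the weight does not decrease, so [gamma * ln N >= 0], with [ln N > 0]. *)
Lemma weight_gamma_ge0 (R : realType) (lam : nat -> R) (lamt : R -> R) (N : nat) :
  interpolates lam lamt -> (1 < N)%N -> 0 <= weight_gamma lamt N%:R.
Proof.
move=> hint N1; have := @interpolates_ln_growth _ _ _ N%:R 1 N%:R hint (lexx _).
rewrite ler1n lexx (ltnW N1) => /(_ isT isT).
case: (hint) => pos mono _ _ _.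
have h : ln (lamt 1) <= ln (lamt N%:R).
  by rewrite ler_ln ?posrE ?mono ?pos ?ler1n // ltnW.
rewrite ln1 subr0 => h2.
have l0 : 0 < ln N%:R :> R by rewrite ln_gt0 // ltr1n.
by rewrite -(pmulr_lge0 _ l0); lra.
Qed.

(** * Exponential series, factorials and numerical constants *)

Lemma expR_partial_sum (R : realType) (x : R) m : 0 <= x ->
  \sum_(0 <= i < m) x ^+ i / (i`!)%:R <= expR x.
Proof.
move=> x0; have nd : nondecreasing_seq (series (exp_coeff x)).
  apply/nondecreasing_seqP => k; rewrite /series /= big_nat_recr //= lerDl.
  by apply: exp_coeff_ge0.
exact: (nondecreasing_cvgn_le nd (is_cvg_series_exp_coeff x) m).
Qed.

Lemma exprn_div_fact_le (R : realType) (x : R) m : 0 <= x ->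
  x ^+ m / (m`!)%:R <= expR x.
Proof.
move=> x0; apply: le_trans (expR_partial_sum m.+1 x0).
rewrite big_nat_recr //= lerDr; apply: sumr_ge0 => i _.
by rewrite divr_ge0 ?exprn_ge0.
Qed.

(* The terms [x ^ i / i!] increase for [i <= x = 2 K], so that [K + 1] of them
   dominate the [n]-th one. *)
Lemma mul_exprn_div_fact_le (R : realType) (K n : nat) : (n <= K)%N ->
  K%:R * ((2 * K)%:R ^+ n / (n`!)%:R) <= expR (2 * K)%:R :> R.
Proof.
move=> nK; set x : R := (2 * K)%:R.
have x0 : 0 <= x by [].
have t0 i : 0 <= x ^+ i / (i`!)%:R by rewrite divr_ge0 ?exprn_ge0.
have mono i : (n + i <= 2 * K)%N ->
    x ^+ n / (n`!)%:R <= x ^+ (n + i) / ((n + i)`!)%:R.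
  elim: i => [|i IH] h; first by rewrite addn0.
  apply: le_trans (IH (leq_trans _ h)) _; first by rewrite addnS.
  rewrite addnS exprS factS natrM invfM mulrACA.
  by rewrite ler_peMl // ler_pdivlMr ?ltr0n // mul1r ler_nat -addnS.
apply: le_trans (expR_partial_sum (n + K) x0).
rewrite (big_cat_nat (n := n)) ?leq_addr //=.
apply: le_trans (_ : \sum_(n <= i < n + K) x ^+ i / (i`!)%:R <= _); last first.
  by rewrite lerDr sumr_ge0.
have -> : \sum_(n <= i < n + K) x ^+ i / (i`!)%:R =
    \sum_(0 <= i < K) x ^+ (i + n) / ((i + n)`!)%:R.
  by rewrite -{1}[n]add0n big_addn addKn.
rewrite mulr_natl.
rewrite -[X in _ *+ X](subn0 K) -sumr_const_nat.
rewrite !big_nat; apply: ler_sum => i /andP[_ iK].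
by rewrite addnC; apply: mono; lia.
Qed.

(** This is [(1 + 1 / k) ^ k <= e], cleared of denominators so that [k = 0] is included. *)
Lemma succ_exprn_le (R : realType) (k : nat) :
  k.+1%:R ^+ k <= expR 1 * k%:R ^+ k :> R.
Proof.
case: k => [|k]; first by rewrite !expr0 mulr1 -expR0 ler_expR.
have k0 : 0 < k.+1%:R :> R by rewrite ltr0n.
have -> : k.+2%:R = (1 + k.+1%:R^-1) * k.+1%:R :> R.
  by rewrite mulrDl mul1r mulVf ?gt_eqF // natr1.
rewrite exprMn ler_wpM2r ?exprn_ge0 //.
apply: le_trans (_ : expR (k.+1%:R^-1) ^+ k.+1 <= _).
  by rewrite lerXn2r ?nnegrE ?addr_ge0 ?invr_ge0 ?expR_ge0 // expR_ge1Dx.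
by rewrite -expRM_natl mulfV // gt_eqF.
Qed.

(** The Stirling-type bound [k! >= e (k / e) ^ k]; [succ_exprn_le] is its induction step. *)
Lemma exprnn_le_fact (R : realType) (k : nat) : (0 < k)%N ->
  k%:R ^+ k * expR 1 <= (k`!)%:R * expR 1 ^+ k :> R.
Proof.
case: k => // k _; elim: k => [|k IH]; first by rewrite !expr1.
rewrite exprS factS natrM [expR 1 ^+ k.+2]exprS.
rewrite [leRHS](_ : _ = k.+2%:R * (expR 1 * ((k.+1)`!%:R * expR 1 ^+ k.+1))).
  rewrite -mulrA ler_wpM2l //.
  apply: le_trans (_ : (expR 1 * k.+1%:R ^+ k.+1) * expR 1 <= _).
    by rewrite ler_wpM2r ?expR_ge0 // succ_exprn_le.
  by rewrite -mulrA ler_wpM2l ?expR_ge0.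
by ring.
Qed.

Lemma expR1_ge2 (R : realType) : 2 <= expR 1 :> R.
Proof. exact: expR_ge1Dx. Qed.

(** The left side is the numerical factor of Lagrange's bound: [2 ^ N] from the coefficients,
    [(N + 1) ^ N] from the spacing. Split [N ^ N] and use [N ^ k / k! <= e ^ N] with
    [k = N - n - 1]. *)
Lemma prefactor_le (R : realType) (N n : nat) : (n < N)%N ->
  (2 * N.+1%:R) ^+ N / ((N - n.+1)`!)%:R <=
  2 ^+ N * expR 1 ^+ N.+1 * N%:R ^+ n.+1 :> R.
Proof.
move=> nN; rewrite exprMn -!mulrA ler_wpM2l ?exprn_ge0 //.
have -> : expR 1 ^+ N.+1 = expR 1 * expR N%:R :> R.
  by rewrite exprS -expRM_natl mulr1.
apply: le_trans (_ : (expR 1 * N%:R ^+ N) / ((N - n.+1)`!)%:R <= _).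
  by rewrite ler_wpM2r ?invr_ge0 // succ_exprn_le.
rewrite -!mulrA ler_wpM2l ?expR_ge0 // -[X in _ ^+ X / _](subnK nN) exprD mulrAC.
by rewrite ler_wpM2r ?exprn_ge0 // exprn_div_fact_le.
Qed.

Lemma remez_constant_flat (R : realType) (K : nat) : (0 < K)%N ->
  expR 1 ^+ K.+1 * ((2 * (2 * K).+1%:R) ^+ (2 * K) / ((2 * K - 1)`!)%:R) <=
  (4 * expR 1 ^+ 4) ^+ (2 * K) * (2 * K).+1%:R ^+ 2 :> R.
Proof.
move=> K0; set N := (2 * K)%N.
have e1 : 1 <= expR 1 :> R by have := expR1_ge2 R; lra.
apply: le_trans (ler_wpM2l (exprn_ge0 _ (expR_ge0 1)) (@prefactor_le R N 0 _)) _.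
  by rewrite /N; lia.
rewrite exprMn -exprM expr1.
rewrite [leLHS](_ : _ = 2 ^+ N * (expR 1 ^+ K.+1 * expR 1 ^+ N.+1) * N%:R); last by ring.
rewrite -exprD; apply: ler_pM; rewrite ?mulr_ge0 ?exprn_ge0 ?expR_ge0 //.
  apply: ler_pM; rewrite ?exprn_ge0 ?expR_ge0 //.
    by rewrite lerXn2r ?nnegrE //; lra.
  by rewrite ler_weXn2l //; rewrite /N; lia.
by rewrite -natrX ler_nat; lia.
Qed.

(** The last factor on the left comes from [pieces_power_le]; its denominators cancel the power of
    [N] in [prefactor_le]. There remain [2 n <= N] and [4 (K + 1) <= (N + 1) ^ 2]. *)
Lemma remez_constant_steep (R : realType) (K n : nat) : (0 < K)%N -> (n <= K)%N ->
  expR 1 ^+ (K.+1 - n) * ((2 * (2 * K).+1%:R) ^+ (2 * K) / ((2 * K - n.+1)`!)%:R) *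
    ((4 * expR 1 ^+ 2 / (2 * K)%:R) ^+ n * (4 * expR 1 * K.+1%:R / (2 * K)%:R)) <=
  (4 * expR 1 ^+ 4) ^+ (2 * K) * (2 * K).+1%:R ^+ 2 :> R.
Proof.
move=> K0 nK; set N := (2 * K)%N.
have N0 : 0 < N%:R :> R by rewrite ltr0n /N; lia.
have e1 : 1 <= expR 1 :> R by have := expR1_ge2 R; lra.
have e0 : 0 <= expR 1 :> R by exact: expR_ge0.
have q0 : 0 <= (4 * expR 1 ^+ 2 / N%:R) ^+ n * (4 * expR 1 * K.+1%:R / N%:R) :> R.
  by rewrite mulr_ge0 ?exprn_ge0 ?divr_ge0 ?mulr_ge0 ?exprn_ge0 //; lra.
apply: le_trans (ler_wpM2r q0 (ler_wpM2l (exprn_ge0 _ e0) (@prefactor_le R N n _))) _.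
  by rewrite /N; lia.
rewrite [leLHS](_ : _ = 2 ^+ N * 4 ^+ n *
   (expR 1 ^+ (K.+1 - n) * expR 1 ^+ N.+1 * (expR 1 ^+ 2) ^+ n * expR 1) *
   (4 * K.+1%:R)); last first.
  rewrite !exprMn exprVn [N%:R ^+ n.+1]exprS; field.
  by rewrite !gt_eqF ?exprn_gt0.
rewrite -exprM -[X in _ * X * _](mulrA _ _ (expR 1)) -exprSr -!exprD.
rewrite [(4 * _) ^+ N]exprMn -[(_ ^+ 4) ^+ N]exprM; apply: ler_pM; rewrite ?mulr_ge0 ?exprn_ge0 //.
  apply: ler_pM; rewrite ?mulr_ge0 ?exprn_ge0 //.
    have -> : 4 = 2 ^+ 2 :> R by rewrite expr2; ring.
    by rewrite -!exprM -exprD ler_weXn2l ?ler1n // /N; lia.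
  by rewrite ler_weXn2l // /N; lia.
by rewrite -natrX -natrM ler_nat /N; nia.
Qed.

Lemma expR_natB (R : realType) (n k : nat) : (n <= k)%N ->
  expR (n%:R - k%:R) = (expR 1 ^+ (k - n))^-1 :> R.
Proof.
by move=> nk; rewrite -expRM_natl mulr1 -expRN natrB // opprB.
Qed.

(** With [k = 2 K - n] one has [2 K <= 2 k], so [lamN * l <= k / e ^ 2], and [exprnn_le_fact] bounds
    the error by [e ^ (- k - 1) Ln]. As [k + 1 = K + (K + 1 - n)], the spare [e ^ (- K)] gives the
    factor one half. *)
Lemma interp_error_le (R : realType) (K n : nat) (l LN Ln lamN : R) :
  (0 < K)%N -> (n <= K)%N -> 0 <= l -> 0 <= Ln -> 0 <= lamN ->
  LN <= Ln * lamN ^+ (2 * K - n) ->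
  lamN * l * (2 * expR 1 ^+ 2) <= (2 * K)%:R ->
  LN * l ^+ (2 * K - n) / ((2 * K - n)`!)%:R <=
    2^-1 * (expR 1 ^+ (K.+1 - n))^-1 * Ln.
Proof.
move=> K0 nK l0 Ln0 lam0 hL hl; set k := (2 * K - n)%N.
have k0 : (0 < k)%N by rewrite /k; lia.
have kK : (k.+1 = K + (K.+1 - n))%N by rewrite /k; lia.
have k2 : (2 * K <= 2 * k)%N by rewrite /k; lia.
have c0 : 0 < expR 1 :> R by exact: expR_gt0.
have c2 := expR1_ge2 R.
have c1 : 1 <= expR 1 :> R by exact: le_trans (ler1n _ 2%N) c2.
have kf : 0 < (k`!)%:R :> R by rewrite ltr0n fact_gt0.
have h1 : lamN * l <= k%:R / expR 1 ^+ 2.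
  rewrite ler_pdivlMr ?exprn_gt0 //.
  have : (2 * K)%:R <= 2 * k%:R :> R by rewrite -natrM ler_nat.
  by move: hl; rewrite mulrCA; lra.
have h2 : LN * l ^+ k <= Ln * (k%:R / expR 1 ^+ 2) ^+ k.
  apply: le_trans (_ : Ln * (lamN * l) ^+ k <= _).
    by rewrite exprMn mulrA ler_wpM2r ?exprn_ge0.
  by rewrite ler_wpM2l // lerXn2r ?nnegrE ?mulr_ge0 // ?divr_ge0 ?exprn_ge0 // ltW.
have h3 := @exprnn_le_fact R k k0.
have e1 : expR 1 ^+ k.+1 = expR 1 ^+ K * expR 1 ^+ (K.+1 - n) :> R.
  by rewrite -exprD -kK.
have h4 : 2 <= expR 1 ^+ K :> R.
  by apply: le_trans c2 _; apply: ler_eXnr.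
apply: le_trans (_ : Ln * (k%:R / expR 1 ^+ 2) ^+ k / (k`!)%:R <= _).
  by rewrite ler_wpM2r // invr_ge0 ltW.
rewrite [leRHS]mulrC -mulrA ler_wpM2l //.
rewrite ler_pdivrMr //.
rewrite exprMn exprVn -exprM mul2n -addnn exprD.
set x := expR 1 ^+ k in h3 *; have x0 : 0 < x by rewrite exprn_gt0.
rewrite ler_pdivrMr ?mulr_gt0 //.
rewrite -(ler_pM2r c0); apply: le_trans h3 _.
set y := expR 1 ^+ (K.+1 - n) in e1 *; have y0 : 0 < y by rewrite exprn_gt0.
have e2 : x * expR 1 = expR 1 ^+ K * y by rewrite -e1 exprSr.
rewrite [leRHS](_ : _ = (k`!)%:R * x * (2^-1 * expR 1 ^+ K)); last first.
  rewrite [LHS](_ : _ = 2^-1 * y^-1 * (k`!)%:R * x * (x * expR 1)); last ring.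
  by rewrite e2; field; rewrite gt_eqF.
by rewrite ler_peMr ?mulr_ge0 ?(ltW x0) // ler_pdivlMl // mulr1.
Qed.

(** * The number of pieces and the local estimate *)

(** The product over [i <= n] of [lam_N <= lam_i (N / i) ^ g], with the power written through [expR]
    and [ln]. *)
Lemma prod_ratio_le (R : realType) (lam : nat -> R) (g : R) (N n : nat) :
  (forall n, 0 < lam n.+1) ->
  (forall i j, (0 < i)%N -> (i <= j <= N)%N ->
     lam j <= lam i * expR (g * (ln j%:R - ln i%:R))) ->
  (n <= N)%N ->
  lam N ^+ n <= \prod_(1 <= i < n.+1) lam i *
    expR (g * ln (N%:R ^+ n / (n`!)%:R)).
Proof.
move=> lam0 hr; elim: n => [|n IH] nN.
  by rewrite big_geq // expr0 mul1r fact0 divr1 ln1 mulr0 expR0.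
have N0 : 0 < N%:R :> R by rewrite ltr0n; lia.
rewrite big_nat_recr //= exprSr.
have -> : ln (N%:R ^+ n.+1 / (n.+1`!)%:R) =
    ln (N%:R ^+ n / (n`!)%:R) + (ln N%:R - ln n.+1%:R) :> R.
  rewrite -ln_div ?posrE //.
  have -> : N%:R ^+ n.+1 / (n.+1`!)%:R = N%:R ^+ n / (n`!)%:R * (N%:R / n.+1%:R) :> R.
    by rewrite exprSr factS mulnC natrM invfM mulrACA.
  by rewrite [in LHS]lnM ?posrE ?divr_gt0 ?exprn_gt0 // ltr0n fact_gt0.
rewrite mulrDr expRD mulrACA; apply: ler_pM.
- by rewrite exprn_ge0 // -(prednK (leq_trans (ltn0Sn n) nN)) ltW.
- by rewrite -(prednK (leq_trans (ltn0Sn n) nN)) ltW.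
- exact: IH (ltnW nN).
- by apply: hr => //; rewrite nN leqnn.
Qed.

(** The sum has at most [K + 1] terms, none larger than the first. *)
Lemma first_weight_le (R : realType) (lam : nat -> R) (j K : nat) (a : R) :
  (forall n, 0 < lam n.+1) ->
  (forall n m, (n <= m)%N -> lam n.+1 <= lam m.+1) ->
  a <= \sum_(j.+1 <= i < K.+2) (expR 1 * lam i)^-1 ->
  a * (expR 1 * lam j.+1) <= K.+1%:R.
Proof.
move=> lam0 hlam ha.
have c0 : 0 < expR 1 * lam j.+1 by rewrite mulr_gt0 ?expR_gt0.
rewrite -ler_pdivlMr //; apply: le_trans ha _.
apply: le_trans (_ : \sum_(j.+1 <= i < K.+2) (expR 1 * lam j.+1)^-1 <= _).
  rewrite !big_nat; apply: ler_sum => -[//|i] /andP[ji _].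
  rewrite lef_pV2 ?posrE ?mulr_gt0 ?expR_gt0 //.
  by rewrite ler_wpM2l ?expR_ge0 // hlam.
rewrite sumr_const_nat [leRHS]mulr_natl; apply: ler_wpMn2l; last by rewrite subSS leq_subr.
by rewrite invr_ge0 ltW.
Qed.

(** Of the [n + 1] factors [lam_N], [prod_ratio_le] trades [n] for [lam_1, ..., lam_n]; the last is
    paid by the length bound on [a * lam_(j+1)]. *)
Lemma pieces_power_le (R : realType) (lam : nat -> R) (g a P : R) (K j n : nat) :
  (forall n, 0 < lam n.+1) -> 0 <= g -> 0 <= a -> 0 <= P ->
  (0 < K)%N -> (n <= K)%N -> (0 < j <= K)%N ->
  (forall i j, (0 < i)%N -> (i <= j <= 2 * K)%N ->
     lam j <= lam i * expR (g * (ln j%:R - ln i%:R))) ->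
  a * (expR 1 * lam j.+1) <= K.+1%:R ->
  P <= 4 * expR 1 ^+ 2 / (2 * K)%:R * a * lam (2 * K)%N ->
  P ^+ n.+1 <= \prod_(1 <= i < n.+1) lam i * (a ^+ n *
   ((4 * expR 1 ^+ 2 / (2 * K)%:R) ^+ n * (4 * expR 1 * K.+1%:R / (2 * K)%:R)) *
   expR (g * (2 * K)%:R)).
Proof.
move=> lam0 g0 a0 P0 K0 nK /andP[j0 jK] hr haj hP; set N := (2 * K)%N.
have nN : (n <= N)%N by rewrite /N mul2n -addnn; exact: leq_trans (leq_addr _ _).
have jN : (0 < j.+1)%N && (j.+1 <= N <= N)%N.
  by rewrite leqnn andbT /N; move: j0 jK; clear; lia.
have N0 : 0 < N%:R :> R by rewrite ltr0n /N muln_gt0.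
set B := 4 * expR 1 ^+ 2 / N%:R.
have K0' : 0 < K%:R :> R by rewrite ltr0n.
have c0 : 0 < expR 1 :> R by exact: expR_gt0.
have B0 : 0 <= B by rewrite /B divr_ge0 ?mulr_ge0 ?exprn_ge0 ?ltW.
have lamN : 0 < lam N by rewrite /N; case: (K) K0 => // k _; rewrite mulnS; exact: lam0.
have h1 : P ^+ n.+1 <= (B * a) ^+ n * lam N ^+ n * (B * (a * lam N)).
  apply: le_trans (_ : (B * a * lam N) ^+ n.+1 <= _).
    by rewrite lerXn2r ?nnegrE // ?mulr_ge0 // ltW.
  by rewrite exprSr [(B * a * lam N) ^+ n]exprMn -!mulrA.
(* Since [j >= 1], the ratio [N / (j + 1)] is at most [K]: this is the extra factor that
   [mul_exprn_div_fact_le] absorbs. *)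
have h2 : a * lam N <= K.+1%:R / expR 1 * expR (g * ln K%:R).
  apply: le_trans (_ : a * (lam j.+1 * expR (g * (ln N%:R - ln j.+1%:R))) <= _).
    by rewrite ler_wpM2l //; case/andP: jN => ? ?; exact: hr.
  rewrite mulrA ler_pM ?mulr_ge0 ?expR_ge0 ?(ltW (lam0 _)) //.
    by rewrite ler_pdivlMr // -mulrA (mulrC (lam _)).
  rewrite ler_expR ler_wpM2l // -ln_div ?posrE //.
  rewrite ler_ln ?posrE ?divr_gt0 // ler_pdivrMr // /N natrM.
  by rewrite mulrC ler_wpM2l // ler_nat.
have h3 := prod_ratio_le lam0 hr nN; rewrite -/N in h3.
set Pi := \prod_(1 <= i < n.+1) lam i in h3 *.
have Pi0 : 0 <= Pi by rewrite /Pi big_nat prodr_ge0 // => -[//|i] _; exact: ltW.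
have h4 : expR (g * ln (N%:R ^+ n / (n`!)%:R)) * expR (g * ln K%:R) <=
    expR (g * N%:R) :> R.
  rewrite -expRD -mulrDr ler_expR ler_wpM2l //.
  have t0 : 0 < N%:R ^+ n / (n`!)%:R :> R.
    by rewrite divr_gt0 ?exprn_gt0 // ltr0n fact_gt0.
  rewrite -lnM ?posrE // -[leRHS]expRK ler_ln ?posrE ?(mulr_gt0 t0 K0') ?expR_gt0 //.
  by rewrite mulrC mul_exprn_div_fact_le.
apply: le_trans h1 _.
apply: le_trans (_ : (B * a) ^+ n * (Pi * expR (g * ln (N%:R ^+ n / (n`!)%:R))) *
   (B * (K.+1%:R / expR 1 * expR (g * ln K%:R))) <= _).
  apply: ler_pM; rewrite ?mulr_ge0 ?exprn_ge0 ?mulr_ge0 ?(ltW lamN) //.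
    by rewrite ler_wpM2l ?exprn_ge0 ?mulr_ge0.
  by rewrite ler_wpM2l.
rewrite [leLHS](_ : _ = Pi * (a ^+ n * (B ^+ n * (4 * expR 1 * K.+1%:R / N%:R))) *
   (expR (g * ln (N%:R ^+ n / (n`!)%:R)) * expR (g * ln K%:R))); last first.
  by rewrite exprMn /B; field; rewrite !gt_eqF.
rewrite -[leLHS]mulrA; apply: ler_wpM2l => //; apply: ler_wpM2l => //.
by rewrite !mulr_ge0 ?exprn_ge0 ?invr_ge0 ?(ltW c0) ?(ltW N0).
Qed.

Lemma le_of_local_nodes (R : realType) (F : nat -> R -> R) (x : nat -> R)
    (K n : nat) (u v y a e p lamN Ln LN S : R) : (0 < K)%N -> (n <= K)%N ->
  0 < a -> 0 < e -> 0 < p -> v - u = a / p -> u <= y <= v ->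
  derivative_chain (2 * K).+1 u v F ->
  0 <= Ln -> 0 <= lamN -> LN <= Ln * lamN ^+ (2 * K - n) ->
  lamN * (a / p) * (2 * expR 1 ^+ 2) <= (2 * K)%:R ->
  (forall z, u <= z <= v -> `|F (2 * K).+1 z| <= LN) ->
  (forall i, (i < 2 * K)%N -> x i + e / p / (2 * K).+1%:R <= x i.+1) ->
  (forall i, (i <= 2 * K)%N -> u <= x i <= v) ->
  (forall i, (i <= 2 * K)%N -> `|F 0%N (x i)| <= S) ->
  expR (n%:R - K.+1%:R) * Ln <= `|F n.+1 y| ->
  Ln <= 2 * (expR 1 ^+ (K.+1 - n) *
     ((2 * (2 * K).+1%:R) ^+ (2 * K) / ((2 * K - n.+1)`!)%:R)) *
     (a ^+ (2 * K - n.+1) * p ^+ n.+1 / e ^+ (2 * K)) * S.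
Proof.
move=> K0 nK a0 e0 p0 uva hy hF Ln0 lam0 hLN hl hM hx huv hS hlow.
have nN : (n < 2 * K)%N by move: K0 nK; clear; lia.
set N := (2 * K)%N in nN *.
have d0 : 0 < e / p / N.+1%:R by rewrite !divr_gt0.
have l0 : 0 <= a / p by rewrite divr_ge0 ?ltW.
have := norm_derivative_le_interp d0 nN hF hM hx huv hS hy.
rewrite uva subSS => h.
have herr := interp_error_le K0 nK l0 Ln0 lam0 hLN hl.
rewrite -/N in herr.
move: hlow; rewrite expR_natB; last exact: leqW.
set D := expR 1 ^+ (K.+1 - n) in herr *; have D0 : 0 < D by rewrite exprn_gt0 ?expR_gt0.
move=> hlow; have {h hlow} := le_trans hlow h.
set T := S * _ * _ / _.
(* The interpolation error is at most half of the lower bound and is absorbed on the left. *)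
move=> hT; have {}hT : D^-1 * Ln <= 2 * T by move: herr hT; lra.
have -> : 2 * (D * ((2 * N.+1%:R) ^+ N / ((N - n.+1)`!)%:R)) *
     (a ^+ (N - n.+1) * p ^+ n.+1 / e ^+ N) * S = D * (2 * T).
  have fz : ((N - n.+1)`!)%:R != 0 :> R by rewrite pnatr_eq0 -lt0n fact_gt0.
  have gz : (N ^_ n.+1)%:R != 0 :> R by rewrite pnatr_eq0 -lt0n ffact_gt0.
  rewrite /T -(ffact_fact nN) natrM !exprMn !exprVn.
  have -> : p ^+ N = p ^+ (N - n.+1) * p ^+ n.+1 by rewrite -exprD subnK.
  by field; rewrite fz gz !expf_neq0 ?gt_eqF.
by rewrite -ler_pdivrMl // mulrC.
Qed.

Lemma lebesgue_size_le (R : realType) (E : set R) (u v : R) :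
  u <= v -> E `<=` `[u, v] -> lebesgue_size E <= v - u.
Proof.
move=> uv Euv; rewrite -(lebesgue_size_itvcc uv).
have h := le_outer_measure (lebesgue_outer R) _ _ Euv.
have hI : lebesgue_outer R `[u, v]%classic = (v - u)%:E.
  by rewrite lebesgue_outerE completed_lebesgue_measure_itvcc.
apply: fine_le => //; rewrite -lebesgue_outerE.
  by rewrite ge0_fin_numE ?outer_measure_ge0 // (le_lt_trans h) // hI ltry.
by rewrite hI.
Qed.

(** The factor [expR (g * N)] merges into the [N]-th power, and one more ratio [a / e >= 1] gives
    the exponents [N] and [N + 1]. *)
Lemma remez_constant_absorb (R : realType) (a e g S W B : R) (N : nat) :
  0 < e -> e <= a -> 0 <= S -> (0 < N)%N ->
  W <= (4 * expR 1 ^+ 4) ^+ N * B -> 0 <= B ->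
  2 * W * (a ^+ (N - 1) / e ^+ N) * expR (g * N%:R) * S <=
  2 * (4 * expR (4 + g)) ^+ N * (a ^+ N / e ^+ N.+1) * B * S.
Proof.
move=> e0 ea S0 N0 hW B0; rewrite ler_wpM2r //.
have a0 : 0 < a by exact: lt_le_trans ea.
have -> : (4 * expR (4 + g)) ^+ N = (4 * expR 1 ^+ 4) ^+ N * expR (g * N%:R).
  rewrite expRD.
  have -> : expR 4 = expR 1 ^+ 4 :> R by rewrite -expRM_natl mulr1.
  by rewrite expRM_natr -exprMn mulrA.
have h : a ^+ (N - 1) / e ^+ N <= a ^+ N / e ^+ N.+1.
  have -> : a ^+ N = a * a ^+ (N - 1) by rewrite -exprS subn1 prednK.
  rewrite exprS invfM mulrACA.
  apply: ler_peMl; first by rewrite divr_ge0 ?exprn_ge0 ?(ltW e0) ?(ltW a0).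
  by rewrite ler_pdivlMr ?mul1r.
set q1 := a ^+ _ / _ in h *; set q2 := a ^+ _ / _ in h *.
have q0 : 0 <= q1 by rewrite /q1 divr_ge0 ?exprn_ge0 ?ltW.
set T := (4 * _) ^+ N in hW *; set x := expR _.
have x0 : 0 <= x by exact: expR_ge0.
rewrite [leLHS](_ : _ = 2 * x * (W * q1)); last by ring.
rewrite [leRHS](_ : _ = 2 * x * (T * B * q2)); last by ring.
rewrite ler_wpM2l ?mulr_ge0 //.
apply: le_trans (_ : T * B * q1 <= _); first by rewrite ler_wpM2r.
by rewrite ler_wpM2l ?mulr_ge0 // /T exprn_ge0 // mulr_ge0 ?exprn_ge0 ?expR_ge0.
Qed.

(** * The Remez-type inequality for derivative chains *)

Lemma remez_derivative_chain (R : realType) (F : nat -> R -> R) (lam : nat -> R)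
    (K j : nat) (u v y A g S : R) (E : set R) :
  u < v -> (0 < K)%N -> (0 < j <= K)%N -> 0 < A -> 0 <= g ->
  derivative_chain (2 * K).+1 u v F ->
  (forall n, 0 < lam n.+1) ->
  (forall n m, (n <= m)%N -> lam n.+1 <= lam m.+1) ->
  (forall n z, (n <= 2 * K)%N -> u <= z <= v ->
     `|F n.+1 z| <= A * \prod_(1 <= i < n.+1) lam i) ->
  (forall i k, (0 < i)%N -> (i <= k <= 2 * K)%N ->
     lam k <= lam i * expR (g * (ln k%:R - ln i%:R))) ->
  v - u <= \sum_(j.+1 <= i < K.+2) (expR 1 * lam i)^-1 ->
  u <= y <= v -> expR (- j%:R) * A <= `|F 1%N y| ->
  E `<=` `[u, v] -> 0 < lebesgue_size E ->
  (forall x, E x -> `|F 0%N x| <= S) ->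
  A <= 2 * (4 * expR (4 + g)) ^+ (2 * K) *
     ((v - u) ^+ (2 * K) / lebesgue_size E ^+ (2 * K).+1) *
     (2 * K).+1%:R ^+ 2 * S.
Proof.
move=> uv K0 jK A0 g0 hF lam0 hlam hFL hr hsum hy hyA Euv e0 hS.
have j0 : (0 < j)%N by case/andP: jK.
set N := (2 * K)%N in hF hFL hr *; set a := v - u; set e := lebesgue_size E in e0 *.
have a0 : 0 < a by rewrite /a subr_gt0.
have KN : (K.+1 <= N)%N by rewrite /N; move: K0; clear; lia.
have N0 : 0 < N%:R :> R by rewrite ltr0n; exact: leq_trans KN.
have c0 : 0 < expR 1 :> R by exact: expR_gt0.
pose L n := A * \prod_(1 <= i < n.+1) lam i.
have LS n : L n.+1 = L n * lam n.+1 by rewrite /L big_nat_recr //= mulrA.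
have L0 n : 0 < L n.
  elim: n => [|n IH]; first by rewrite /L big_geq // mulr1.
  by rewrite LS mulr_gt0.
have LA : L 0%N = A by rewrite /L big_geq // mulr1.
have lamN : 0 < lam N by rewrite -(prednK (leq_trans (ltn0Sn K) KN)).
have LN n : (n <= N)%N -> L N <= L n * lam N ^+ (N - n).
  move=> nN; rewrite -{1}(subnKC nN).
  have : (n + (N - n) <= N)%N by rewrite subnKC.
  elim: (N - n)%N => [|k IH] nk; first by rewrite addn0 expr0 mulr1.
  rewrite addnS LS exprSr mulrA ler_pM ?(ltW (L0 _)) ?(ltW (lam0 _)) //.
    by apply: IH; apply: leq_trans nk; rewrite addnS.
  rewrite -(prednK (leq_trans (ltn0Sn K) KN)) hlam //.
  by rewrite -ltnS prednK ?(leq_trans (ltn0Sn K) KN) // -addnS.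
have ea : e <= a by apply: lebesgue_size_le => //; exact: ltW.
have Nn0 : (0 < N)%N by exact: leq_trans KN.
have spaced p := @exists_spaced_points R E u v p N (ltW uv) Euv e0.
have inuv z : E z -> u <= z <= v by move=> /Euv; rewrite /= in_itv.
(* A short interval is a single piece: order [n = 0] at [y] suffices, without Bang's argument. *)
have [hshort|hlong] := leP (lam N * a * (2 * expR 1 ^+ 2)) N%:R.
  have [_ [x [_ xE _ hx]]] := spaced 1%N isT.
  have S0 : 0 <= S by exact: le_trans (hS _ (xE 0%N isT)).
  have := @le_of_local_nodes R F x K 0 u v y a e 1 (lam N) (L 0%N) (L N) S K0
    (leq0n K) a0 e0 ltr01 _ hy hF (ltW (L0 _)) (ltW lamN) (LN 0%N _) _ _ hx _ _ _.
  rewrite divr1 => /(_ erefl isT hshort) h.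
  apply: le_trans (_ : A <= _) _ => //; rewrite -{1}LA.
  apply: le_trans (h _ _ _ _) _.
  - by move=> z hz; apply: hFL.
  - by move=> i /xE /inuv.
  - by move=> i /xE /hS.
  (* For [n = 0] the lower bound needed is [exp (- K - 1) A], weaker than the one at [y] because
     [j <= K]. *)
  - rewrite LA; apply: le_trans hyA; rewrite ler_wpM2r ?(ltW A0) // ler_expR.
    rewrite sub0r lerN2 ler_nat; case/andP: jK => _ h'; exact: leqW.
  rewrite subn0 expr1 mulr1.
  have hW := @remez_constant_flat R K K0.
  have := @remez_constant_absorb R a e g S _ _ N e0 ea S0 Nn0 hW (exprn_ge0 _ (ler0n _ _)).
  apply: le_trans.
  apply: ler_wpM2r => //; apply: ler_peMr.
    by rewrite !mulr_ge0 ?invr_ge0 ?exprn_ge0 ?mulr_ge0 ?(ltW a0) ?(ltW e0) ?(ltW c0).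
  by rewrite -expR0 ler_expR mulr_ge0.
(* [X] is the length of the interval over the admissible length of a piece. As [X > 1], rounding it
   up costs at most a factor [2]. *)
pose X := lam N * a * (2 * expR 1 ^+ 2) / N%:R.
have X1 : 1 < X by rewrite /X ltr_pdivlMr // mul1r.
pose p := (Num.truncn X).+1.
have /andP[pX Xp] := truncn_itv (ltW (lt_trans ltr01 X1)).
have p0 : 0 < p%:R :> R by rewrite ltr0n.
have p2X : p%:R <= 2 * X by rewrite /p -natr1; lra.
have [q [x [qp xE xJ hx]]] := spaced p isT.
set h := (v - u) / p%:R in xJ.
have S0 : 0 <= S by exact: le_trans (hS _ (xE 0%N isT)).
have h0 : 0 <= h by rewrite /h divr_ge0 // ltW.
have vE : v = u + p%:R * h by rewrite /h mulrC divfK ?gt_eqF // addrC subrK.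
have uJ : u <= u + q%:R * h by rewrite lerDl mulr_ge0.
have Jv : u + q.+1%:R * h <= v by rewrite [leRHS]vE lerD2l ler_wpM2r // ler_nat.
have JJ : u + q%:R * h <= u + q.+1%:R * h.
  by rewrite lerD2l ler_wpM2r // ler_nat.
have hz : u <= u + q%:R * h <= v by rewrite uJ (le_trans JJ).
(* The piece is fixed before [n], which depends on the point tested; its left endpoint is taken. *)
have [n [nK hn]] : exists n, (n <= K)%N /\
    expR (n%:R - K.+1%:R) * L n <= `|F n.+1 (u + q%:R * h)|.
  apply: (@exists_large_derivative R (fun n => F n.+1) L lam u v j K _ y) => //.
  - move=> i iK z zuv; apply: hF => //; rewrite ltnS.
    by apply: leq_trans KN.
  - by move=> i z iK; apply: hFL; apply: leq_trans KN.
  - by rewrite LA.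
have nN : (n <= N)%N by apply: leq_trans (leq_trans nK _) KN.
have lJ : u + q.+1%:R * h - (u + q%:R * h) = a / p%:R.
  by rewrite -natr1 /h -/a; ring.
have := @le_of_local_nodes R F x K n _ _ (u + q%:R * h) a e p%:R (lam N) (L n) (L N) S K0
  nK a0 e0 p0 lJ _ (derivative_chain_sub uJ Jv hF) (ltW (L0 _)) (ltW lamN) (LN n nN) _ _ hx xJ _ hn.
rewrite lexx JJ => /(_ isT).
have hX : lam N * (a / p%:R) * (2 * expR 1 ^+ 2) <= N%:R.
  have : X <= p%:R by exact: ltW.
  rewrite /X ler_pdivrMr // => hX'.
  have -> : lam N * (a / p%:R) * (2 * expR 1 ^+ 2) =
    lam N * a * (2 * expR 1 ^+ 2) / p%:R by ring.
  by rewrite ler_pdivrMr // [leRHS]mulrC.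
have hM z : u + q%:R * h <= z <= u + q.+1%:R * h -> `|F N.+1 z| <= L N.
  by move=> /andP[z1 z2]; apply: hFL; rewrite ?(le_trans uJ z1) ?(le_trans z2 Jv).
have hSx i : (i <= N)%N -> `|F 0%N (x i)| <= S by move=> /xE /hS.
move=> /(_ hX hM hSx).
have hpp : p%:R <= 4 * expR 1 ^+ 2 / N%:R * a * lam N.
  by apply: le_trans p2X _; rewrite /X le_eqVlt; apply/orP; left; apply/eqP; field; rewrite gt_eqF.
have := pieces_power_le lam0 g0 (ltW a0) (ltW p0) K0 nK jK hr
  (first_weight_le lam0 hlam hsum) hpp.
rewrite -/N /L.
set Pi := \prod_(1 <= i < n.+1) lam i.
have Pi0 : 0 < Pi by have := L0 n; rewrite /L pmulr_rgt0.
have hW := @remez_constant_steep R K n K0 nK; rewrite -/N in hW.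
have := @remez_constant_absorb R a e g S _ _ N e0 ea S0 Nn0 hW (exprn_ge0 _ (ler0n _ _)).
set D := expR 1 ^+ _ * _; set Q := (_ ^+ n * _) => habs hpow hL.
apply: le_trans habs.
(* [hL] bounds [A * Pi], and [hpow] bounds the power of [p] by a multiple of the same [Pi], which
   therefore cancels. *)
rewrite -(ler_pM2r Pi0); apply: le_trans hL _.
have D0 : 0 <= D.
  by rewrite /D mulr_ge0 ?divr_ge0 ?exprn_ge0 ?mulr_ge0 ?(ltW c0).
have -> : a ^+ (N - 1) = a ^+ (N - n.+1) * a ^+ n.
  by rewrite -exprD; congr (_ ^+ _); move: nK KN; clear; lia.
apply: le_trans (_ : 2 * D * (a ^+ (N - n.+1) *
  (Pi * (a ^+ n * Q * expR (g * N%:R))) / e ^+ N) * S <= _).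
  rewrite ler_wpM2r // ler_wpM2l ?mulr_ge0 // ler_wpM2r ?invr_ge0 ?exprn_ge0 ?(ltW e0) //.
  by rewrite ler_wpM2l // exprn_ge0 // ltW.
by rewrite le_eqVlt; apply/orP; left; apply/eqP; ring.
Qed.

(** * The start index, the degree and the supremum norm *)

Lemma start_indexP (R : realType) (A b : R) : 0 < b -> b < A ->
  ln (A / b) <= (start_index A b)%:R /\ (0 < start_index A b)%N.
Proof.
move=> b0 bA.
have ln0 : 0 < ln (A / b) by rewrite ln_gt0 // ltr_pdivlMr // mul1r.
have [j hj jmin] : exists2 j : nat, ln (A / b) <= j%:R &
    forall i : nat, ln (A / b) <= i%:R -> (j <= i)%N.
  have ex : exists i : nat, ln (A / b) <= i%:R.
    by exists (Num.truncn (ln (A / b))).+1; apply/ltW/truncnS_gt.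
  by case: (ex_minnP ex) => j hj jmin; exists j.
(* A least index exists, so [xget] returns it and not its default [0]. *)
have [h _] : [set j : nat | ln (A / b) <= j%:R /\
    forall i : nat, ln (A / b) <= i%:R -> (j <= i)%N] (start_index A b).
  by apply: xgetPex; exists j.
split => //; rewrite -(ltr0n R); exact: lt_le_trans ln0 h.
Qed.

Lemma admissible_partial_sum (R : realType) (lam : nat -> R) (j : nat) (c : R) :
  (forall n, 0 < lam n.+1) ->
  (c%:E < \sum_(j.+1 <= i <oo) ((lam i)^-1)%:E)%E ->
  exists k, c < \sum_(j.+1 <= i < k) (lam i)^-1.
Proof.
move=> lam0 hc; apply: contrapT => /forallNP H; move: hc; apply/negP.
rewrite -leNgt; apply: lime_le.
  by apply: is_cvg_nneseries => -[//|i] _ _; rewrite lee_fin invr_ge0 ltW.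
apply: nearW => k; rewrite sumEFin lee_fin leNgt; exact/negP/H.
Qed.

(** [K] is the supremum: the start index is in the set, its sum being empty, and [K + 1] is not, so
    the sum up to [K + 1] reaches [e]; exchanging [a] and [e] gives the last claim. *)
Lemma degree_spec (R : realType) (lam : nat -> R) (A a b : R) :
  (forall n, 0 < lam n.+1) -> 0 < a ->
  ((a * expR 1)%R%:E < \sum_((start_index A b).+1 <= j <oo) ((lam j)^-1)%:E)%E ->
  exists K, [/\ degree lam A a b = (2 * K)%N, (start_index A b <= K)%N &
    a <= \sum_((start_index A b).+1 <= i < K.+2) (expR 1 * lam i)^-1].
Proof.
move=> lam0 a0 hs; set j := start_index A b in hs *.
pose D := [set k : nat | \sum_(j.+1 <= i < k.+1) (a * lam i)^-1 < expR 1].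
exists (supremum 0%N D).
have [k hk] := admissible_partial_sum lam0 hs.
have scale m : \sum_(j.+1 <= i < m) (a * lam i)^-1 = a^-1 * \sum_(j.+1 <= i < m) (lam i)^-1.
  by rewrite mulr_sumr; apply: eq_bigr => i _; rewrite invfM.
(* Admissibility bounds [D], so its supremum is genuine and not the default value. *)
have ub : ubound D k.
  move=> m /= Dm; rewrite leNgt; apply/negP => km; move: Dm; apply/negP.
  rewrite -leNgt scale ler_pdivlMl //; apply: le_trans (ltW hk) _.
  have [jk|jk] := leqP j.+1 k.
    rewrite [leRHS](big_cat_nat (n := k)) ?(leqW (ltnW km)) //= lerDl.
    rewrite big_nat sumr_ge0 // => -[|i] /andP[ki _]; last by rewrite invr_ge0 ltW.
    by have := leq_trans jk ki.
  rewrite big_geq ?(ltnW jk) // big_nat sumr_ge0 // => -[|i] //.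
  by rewrite invr_ge0 ltW.
have sup0 : supremums D !=set0 by apply: nat_supremums_neq0; exists k.
split => //.
  rewrite -leEnat; apply: ge_supremum_Nmem => //.
  by rewrite /D /= big_geq // expR_gt0.
have -> : \sum_(j.+1 <= i < (supremum 0%N D).+2) (expR 1 * lam i)^-1 =
    (expR 1)^-1 * \sum_(j.+1 <= i < (supremum 0%N D).+2) (lam i)^-1.
  by rewrite mulr_sumr; apply: eq_bigr => i _; rewrite invfM.
rewrite ler_pdivlMl ?expR_gt0 // mulrC -ler_pdivlMl // -scale leNgt; apply/negP => h.
have : ((supremum 0%N D).+1 <= supremum 0%N D)%O by apply: ge_supremum_Nmem.
by rewrite leEnat ltnn.
Qed.

Lemma weight_prodS (R : realType) (mu : nat -> R) (M0 : R) n :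
  weight_prod mu M0 n.+1 =
  M0 * mu 1%N * \prod_(1 <= i < n.+1) shift_weight mu i.
Proof. by rewrite /weight_prod big_ltn // big_add1 /= mulrA. Qed.

Lemma shift_weight_gt0 (R : realType) (mu : nat -> R) :
  admissible_weight mu -> forall n, 0 < mu n.+1.
Proof.
move=> [mu1 hmu]; elim=> // n IH; exact: lt_le_trans IH (hmu n.+1 isT).
Qed.

Lemma shift_weight_mono (R : realType) (mu : nat -> R) :
  admissible_weight mu -> forall n m, (n <= m)%N -> mu n.+1 <= mu m.+1.
Proof.
move=> [_ hmu] n m /subnKC <-; elim: (m - n)%N => [|k IH]; first by rewrite addn0.
by rewrite addnS; exact: le_trans IH (hmu (n + k).+1 isT).
Qed.

(** The extreme value theorem supplies the bound without which [sup] would be [0]. *)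
Lemma supnorm_attained (R : realType) (u v : R) (g : R -> R) : u <= v ->
  {within `[u, v], continuous g} ->
  exists2 y, u <= y <= v & supnorm `[u, v]%classic g = `|g y| /\
    forall x, u <= x <= v -> `|g x| <= `|g y|.
Proof.
move=> uv cg.
have cn : {within `[u, v], continuous (fun x => `|g x|)}.
  by move=> x; apply: continuous_comp; [exact: cg|exact: norm_continuous].
have [y yuv hy] := EVT_max uv cn; rewrite in_itv /= in yuv.
have ub : ubound [set `|g x| | x in `[u, v]%classic] `|g y|.
  by move=> _ [x /= xuv <-]; apply: hy.
exists y => //; split; last by move=> x xuv; apply: hy; rewrite in_itv.
apply/eqP; rewrite eq_le; apply/andP; split.
  by apply: ge_sup => //; exists `|g y|, y => //=; rewrite in_itv.
apply: ub_le_sup; first by exists `|g y|.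
by exists y => //=; rewrite in_itv.
Qed.

Lemma le_supnorm (R : realType) (u v : R) (g : R -> R) (E : set R) (x : R) : u <= v ->
  {within `[u, v], continuous g} -> E `<=` `[u, v] -> E x ->
  `|g x| <= supnorm E g.
Proof.
move=> uv cg Euv Ex; have [y _ [_ hy]] := supnorm_attained uv cg.
apply: ub_le_sup; last by exists x.
by exists `|g y| => _ [z /Euv /= zuv <-]; apply: hy; move: zuv; rewrite in_itv.
Qed.

Lemma class_C_derivative_chain (R : realType) n (U : set R) (f : R -> R) (u v : R) :
  `[u, v]%classic `<=` U -> class_C n U f ->
  derivative_chain n u v (fun j => derive1n j f) /\
  forall j, (j <= n)%N -> {within `[u, v], continuous (derive1n j f)}.
Proof.
move=> IU [hd hc].
have ch : derivative_chain n u v (fun j => derive1n j f).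
  move=> j jn x xuv; rewrite derive1nS derive1E; apply: derivableP.
  by apply: hd => //; apply: IU; rewrite /= in_itv.
split => // j; rewrite leq_eqVlt => /predU1P[->|jn].
  by apply: continuous_in_subspaceT => x; rewrite inE => xuv; apply/hc/IU.
exact: is_derive_within_continuous (ch j jn).
Qed.

Theorem proposition10p3 (R : realType) (alpha beta : R) (mu : nat -> R)
    (M0 b1 : R) (lamt f : R -> R) :
  let I : set R := [set` `[alpha, beta]] in
  let M1 : R := M0 * mu 1%N in
  let N : nat := degree (shift_weight mu) M1 (lebesgue_size I) b1 in
  admissible_weight mu ->
  0 < M0 ->
  0 < b1 -> b1 < M1 ->
  admissible_tuple (shift_weight mu) M1 (lebesgue_size I) b1 ->
  interpolates (shift_weight mu) lamt ->
  weight_smooth mu N.+1 M0 I f ->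
  b1 <= supnorm I (derive1 f) ->
  forall E : set R, lebesgue_measurable E -> E `<=` I ->
    0 < lebesgue_size E ->
    supnorm I (derive1 f) <=
      2 * CN_const lamt N * (lebesgue_size I ^+ N / lebesgue_size E ^+ N.+1) *
        (N.+1)%:R ^+ 2 * supnorm E f.
Proof.
move=> I M1 N hmu M00 b10 b1M1 [_ M10 a0 _ hsum] hint [[U [_ IU hC]] hsup] hb1 E _ EI E0.
have mu0 := shift_weight_gt0 hmu; have mumono := shift_weight_mono hmu.
(* An empty or one-point interval has size [0], against admissibility. *)
have ab : alpha < beta.
  rewrite ltNge; apply/negP => ba; move: ba a0; rewrite /I.
  rewrite le_eqVlt => /predU1P[<-|ba]; first by rewrite lebesgue_size_itvcc // subrr ltxx.
  by rewrite /I set_itv_ge ?bnd_simp -?ltNge // /lebesgue_size measure0 ltxx.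
have IE : lebesgue_size I = beta - alpha by rewrite lebesgue_size_itvcc // ltW.
have [K [NE jK aK]] := degree_spec (fun n => mu0 n.+1) a0 hsum.
have [lnj j0] := start_indexP b10 b1M1.
rewrite -/N in NE; set j := start_index M1 b1 in jK aK lnj j0.
have K0 : (0 < K)%N by exact: leq_trans jK.
have [ch cont] := class_C_derivative_chain IU hC.
have [y yI [supE hy]] := supnorm_attained (ltW ab) (cont 1%N isT).
have bound n z : (n <= N.+1)%N -> alpha <= z <= beta ->
    `|derive1n n f z| <= weight_prod mu M0 n.
  move=> nN zI; apply: le_trans (hsup n nN).
  by apply: (le_supnorm (ltW ab) (cont n nN)) => //=; rewrite in_itv.
have hf x : E x -> `|f x| <= supnorm E f.
  by move=> Ex; apply: (le_supnorm (ltW ab) (cont 0%N isT) EI Ex).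
have supM1 : supnorm I (derive1 f) <= M1.
  by apply: le_trans (hsup 1%N isT) _; rewrite weight_prodS big_geq // mulr1.
(* The stronger bound on [M1] itself is proved. *)
apply: le_trans supM1 _; rewrite /CN_const IE NE.
rewrite NE in ch bound; rewrite IE in aK.
apply: (@remez_derivative_chain R (fun n => derive1n n f) (shift_weight mu) K j
  alpha beta y) => //.
- by rewrite j0.
- by apply: weight_gamma_ge0 hint _; rewrite mul2n -addnn; case: (K) K0 => // k _; rewrite addSn addnS.
- by move=> n; apply: mu0.
- by move=> n m nm; apply: mumono.
- by move=> n z nN zI; rewrite -weight_prodS; apply: bound.
- by move=> i k i0 ik; apply: interpolates_ratio hint i0 ik.
(* At the maximum point [y], [ln (M1 / b1) <= j] turns [b1] into the lower bound [exp (- j) M1]. *)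
- rewrite -supE; apply: le_trans hb1.
  rewrite expRN mulrC ler_pdivrMr ?expR_gt0 // mulrC -ler_pdivrMr //.
  by rewrite -[leLHS]lnK ?posrE ?divr_gt0 // ler_expR.
Qed.
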